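(* Let $\mathbb{F}_q$ be a finite field of characteristic $2$ and let $\mathcal{F}=\mathbb{F}_q(x,y)$ be a cubic function field given in standard form by $y^3-Ay+B=0$ with $A,B\in\mathbb{F}_q[x]$. Let $P$ be a finite place of $\mathbb{F}_q(x)$, $m_1=v_P(A)$, $m_0=v_P(B)$, and let $\bar A=A \bmod P$, $\bar B=B\bmod P$. Then the $P$-signature of $\mathcal{F}/\mathbb{F}_q(x)$ is: \begin{itemize} \item $(1,1,1,1,1,1)$ if $m_1>0=m_0$, $q^{\deg(P)}\equiv 1\pmod 3$ and $-B$ is a cube modulo $P$; or if $m_1=m_0=0$ and $T^3-\bar AT+\bar B$ has $3$ roots in $\mathbb{F}_{q^{\deg(P)}}$. \item $(1,1,1,2)$ if $m_1>0=m_0$, $q^{\deg(P)}\equiv -1\pmod 3$ and $-B$ is a cube modulo $P$; or if $m_1=m_0=0$ and $T^3-\bar AT+\bar B$ has $1$ root in $\mathbb{F}_{q^{\deg(P)}}$. \item $(1,1,2,1)$ if $m_1=1<m_0$. \item $(1,3)$ if $m_1>0=m_0$ and $-B$ is not a cube modulo $P$; or if $m_1=m_0=0$ and $T^3-\bar AT+\bar B$ has no roots in $\mathbb{F}_{q^{\deg(P)}}$. \item $(3,1)$ if $1\le m_0\le m_1$. \end{itemize} (No assertion is made in the case $m_1=0<m_0$.)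
   Context: Cubic function field in standard form: $\mathcal{F}=\mathbb{F}_q(x,y)$ where $x$ is transcendental over $\mathbb{F}_q$, $T^3-A(x)T+B(x)\in\mathbb{F}_q[x][T]$ is irreducible over $\mathbb{F}_q(x)$ with root $y$, at least one of $A,B$ is non-constant, there is no non-constant $Q\in\mathbb{F}_q[x]$ with $Q^2\mid A$ and $Q^3\mid B$, and $\mathbb{F}_q$ is algebraically closed in $\mathcal{F}$. Finite places of $\mathbb{F}_q(x)$ are identified with monic irreducible polynomials $P\in\mathbb{F}_q[x]$; $v_P(G)$ is the exact power of $P$ dividing $G$ ($v_P(0)=\infty$), and the residue field $\mathbb{F}_q[x]/(P)$ is identified with $\mathbb{F}_{q^{\deg(P)}}$. The $P$-signature of $\mathcal{F}/\mathbb{F}_q(x)$ is the list of pairs $(e(P_i|P),f(P_i|P))$ of ramification indices and relative (residue) degrees of all places $P_1,\dots,P_m$ of $\mathcal{F}$ above $P$, written as one tuple and ordered lexicographically; e.g. $(1,1,2,1)$ means two places, one with $e=f=1$ and one with $e=2$, $f=1$. *)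

(* Defs.v *)
From HB Require Import structures.
From mathcomp Require Export all_boot all_order all_algebra all_field.
From mathcomp Require Export classical_sets constructive_ereal.
Set Implicit Arguments.
Unset Strict Implicit.
Unset Printing Implicit Defensive.

Import Order.TTheory GRing.Theory Num.Theory.
Local Open Scope classical_set_scope.
Local Open Scope ring_scope.

(* A place of a function field L/k is the maximal ideal of a valuation ring O
   with k < O < L (strict inclusions), and it determines O: places are
   represented by their valuation rings, with k given as a subset of L. *)
Record valuation_ring (L : fieldType) (k O : set L) : Prop := ValuationRing {
  vring1 : O 1;
  vringB : forall a b, O a -> O b -> O (a - b);
  vringM : forall a b, O a -> O b -> O (a * b);
  vring_constants : k `<` O;
  vring_proper : O `<` setT;
  vring_total : forall z, O z \/ O z^-1
}.

Definition vunits (L : fieldType) (O : set L) : set L :=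
  [set z | [/\ z != 0, O z & O z^-1]].

Definition vmax (L : fieldType) (O : set L) : set L := O `\` vunits O.

Definition prime_element (L : fieldType) (O : set L) (t : L) : Prop :=
  vmax O = [set t * w | w in O].

(* The normalized valuation of O takes the value n : int at z (so z != 0);
   n does not depend on the prime element t. *)
Definition has_valuation (L : fieldType) (O : set L) (z : L) (n : int) : Prop :=
  exists t u : L, [/\ prime_element O t, vunits O u & z = u * t ^ n].

Section PlacesAbove.
Variables (K : fieldType) (L : fieldExtType K) (O : set K) (O' : set L).

Definition lies_over : Prop := forall z : K, vmax O z -> vmax O' z%:A.

(* v'(z) = e * v(z) for all nonzero z in K, v and v' being the normalized
   valuations of O and O'. *)
Definition ramification_index (e : nat) : Prop :=
  forall (z : K) (n : int),
    has_valuation O z n -> has_valuation O' z%:A (e%:Z * n).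

(* The dimension of the residue field O'/vmax O' over O/vmax O is f: the
   classes of b_0, ..., b_(f-1) in O'/vmax O' are linearly independent over,
   and span over, O/vmax O. *)
Definition residue_degree (f : nat) : Prop :=
  exists b : 'I_f -> L,
    [/\ forall i, O' (b i),
        forall c : 'I_f -> K, (forall i, O (c i)) ->
          vmax O' (\sum_i c i *: b i) -> forall i, vmax O (c i)
      & forall z, O' z -> exists2 c : 'I_f -> K,
          forall i, O (c i) & vmax O' (z - \sum_i c i *: b i)].

End PlacesAbove.

Section FunctionField.
Variables (Fq : finFieldType) (F : fieldExtType {fraction {poly Fq}}).

Definition ratconst (c : Fq) : {fraction {poly Fq}} := tofrac c%:P.

Definition ffconst (c : Fq) : F := (ratconst c)%:A.

Definition finite_place (P : {poly Fq}) : set {fraction {poly Fq}} :=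
  [set z | exists f g : {poly Fq}, ~~ (P %| g) /\ z = tofrac f / tofrac g].

Definition place_above (P : {poly Fq}) (O : set F) : Prop :=
  valuation_ring (range ffconst) O /\ lies_over (finite_place P) O.

(* s is the tuple (e_1, f_1, ..., e_m, f_m), the pairs (e_i, f_i) being
   lexicographically ordered and O enumerating without repetition all the
   places above P. *)
Definition is_signature (P : {poly Fq}) (s : seq nat) : Prop :=
  exists (m : nat) (ef : m.-tuple (nat *l nat)) (O : 'I_m -> set F),
    [/\ s = flatten [seq [:: p.1; p.2] | p <- ef],
        sorted <=%O ef,
        injective O /\ range O = [set Q | place_above P Q],
        forall i, ramification_index (finite_place P) (O i) (tnth ef i).1
      & forall i, residue_degree (finite_place P) (O i) (tnth ef i).2].

(* F = Fq(x, y) is a cubic function field in standard form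
   y ^ 3 - A y + B = 0; the transcendental x is the variable 'X of
   {fraction {poly Fq}}. *)
Record standard_form (y : F) (A B : {poly Fq}) : Prop := StandardForm {
  sf_irreducible : irreducible_poly
    ('X^3 - (tofrac A)%:P * 'X + (tofrac B)%:P : {poly {fraction {poly Fq}}});
  sf_root : y ^+ 3 - (tofrac A)%:A * y + (tofrac B)%:A = 0;
  sf_gen : <<1; y>>%VS = fullv;
  sf_nonconstant : (1 < size A)%N || (1 < size B)%N;
  sf_minimal : forall Q : {poly Fq}, Q ^+ 2 %| A -> Q ^+ 3 %| B ->
    (size Q <= 1)%N;
  sf_full_constants : forall z : F, algebraicOver ffconst z ->
    exists c : Fq, z = ffconst c
}.

End FunctionField.

(* v_P(G), with v_P(0) = +oo; for P non-constant, P ^+ i %| G with G != 0 forces i < size G. *)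
Definition vpoly (k : fieldType) (P G : {poly k}) : \bar int :=
  if G == 0 then +oo%E
  else ((\max_(i < size G | (P ^+ i %| G)%R) i)%N%:Z)%:E.

Section Residue.
Variables (Fq : finFieldType) (P : {poly Fq}) (hP : monic_irreducible_poly P).

Definition modP (G : {poly Fq}) : {poly %/ P with hP} := in_qpoly P G.

Definition cube_mod (G : {poly Fq}) : Prop :=
  exists t : {poly %/ P with hP}, t ^+ 3 = modP G.

Definition nroots_mod (A B : {poly Fq}) : nat :=
  #|[set t : {poly %/ P with hP} |
      root ('X^3 - (modP A)%:P * 'X + (modP B)%:P) t]%SET|.

End Residue.

(* Main.v *)
From HB Require Import structures.
From mathcomp Require Import boolp ring.
Require Import Defs.
Set Implicit Arguments.
Unset Strict Implicit.
Unset Printing Implicit Defensive.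

Import Order.TTheory GRing.Theory Num.Theory.
Local Open Scope classical_set_scope.
Local Open Scope ring_scope.

(** The proof replaces the general theory of extensions of places by explicit
    localizations of one order R between Fq[x] and F.

    Let M be a maximal ideal of R above P that becomes principal once a single
    element outside M is inverted. Then R_M is a discrete valuation ring, and
    its ramification index and residue degree are visible on R: they are the
    exponent of the uniformizer in P and the dimension of R / M over
    Fq[x] / (P). As a discrete valuation ring is a maximal proper subring,
    R_M is the only place whose maximal ideal contains M
    (localization_unique). Hence the signature is known as soon as some primes
    M of R are listed such that every place above P contains one of them in its
    maximal ideal (signature_of_primes).

    If P does not divide B, take R = Fq[x][y]. In characteristic 2 the
    discriminant of T^3 - A T + B is B^2, so the cubic is squarefree modulo P
    and the theorem of Kummer and Dedekind (kummer_signature) gives one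
    unramified place for each irreducible factor, of residue degree the degree
    of that factor. If P divides A, the cubic is T^3 + B modulo P, and its roots
    are counted by means of the cube roots of unity, whose number depends on
    q^deg P modulo 3.

    In the remaining cases P divides both A and B. Let d = 1 if v_P(B) = 1 and
    d = P otherwise, so that A = d a and B = d^2 c. Then theta = y^2 / d is
    integral, and 1, y, theta span a ring by
        y^2 = d theta,   y theta = a y - d c,   theta^2 = a theta - c y.
    Sending y to 0 and theta to a root s of s^2 = a s defines a prime with
    residue field Fq[x] / (P), and these relations exhibit the uniformizer:
    - v_P(B) = 1 (d = 1): y^3 = - P (unit), and y is a uniformizer;
    - v_P(B) = 2 (d = P, P | a): theta^3 = P (unit), and theta is one;
    - v_P(A) = 1 < v_P(B) (d = P, a prime to P): s = 0 gives a place with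
      uniformizer P, while s = a gives one with uniformizer y and
      P = y^2 / theta.
    The case v_P(B) >= 3 and v_P(A) >= 2 is excluded by minimality of the
    standard form. *)

(** * Valuation rings *)

Section ValuationRings.
Variables (L : fieldType) (k O : set L).
Hypothesis vrO : valuation_ring k O.

Lemma vring0 : O 0.
Proof. by rewrite -(subrr 1); apply: (vringB vrO); apply: (vring1 vrO). Qed.

Lemma vringN a : O a -> O (- a).
Proof. by rewrite -sub0r; move=> Oa; apply: (vringB vrO vring0 Oa). Qed.

Lemma vringD a b : O a -> O b -> O (a + b).
Proof. by move=> Oa Ob; rewrite -[b]opprK; apply: (vringB vrO Oa (vringN Ob)). Qed.

Lemma vringX a n : O a -> O (a ^+ n).
Proof.
by move=> Oa; elim: n => [|n IHn]; rewrite ?exprS; [apply: (vring1 vrO) | apply: (vringM vrO)].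
Qed.

Lemma vring_sum (I : Type) (r : seq I) (Q : pred I) (E : I -> L) :
  (forall i, Q i -> O (E i)) -> O (\sum_(i <- r | Q i) E i).
Proof. by move=> OE; apply: big_ind => //; [apply: vring0 | apply: vringD]. Qed.

Lemma vmaxP z : vmax O z <-> O z /\ (z = 0 \/ ~ O z^-1).
Proof.
split=> [[Oz nUz]|[Oz h]]; split=> //; last first.
  by case=> z0 _ OVz; case: h => // z1; rewrite z1 eqxx in z0.
have [->|z0] := eqVneq z 0; first by left.
by right=> OVz; apply: nUz; split.
Qed.

Lemma vmax_sub z : vmax O z -> O z.
Proof. by case. Qed.

Lemma vmaxMl a z : O a -> vmax O z -> vmax O (a * z).
Proof.
move=> Oa /vmaxP[Oz h]; apply/vmaxP; split; first exact: (vringM vrO).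
have [->|a0] := eqVneq a 0; first by left; rewrite mul0r.
case: h => [->|nOVz]; first by left; rewrite mulr0.
right=> OVaz; apply: nOVz.
by rewrite -(mulVKf a0 z^-1) -invfM; apply: (vringM vrO).
Qed.

Lemma vmaxD a b : vmax O a -> vmax O b -> vmax O (a + b).
Proof.
move=> ma mb.
have [->|a0] := eqVneq a 0; first by rewrite add0r.
have [->|b0] := eqVneq b 0; first by rewrite addr0.
(* the sum is a multiple of whichever term has the smaller valuation *)
case: (vring_total vrO (a / b)) => [Oab|].
  rewrite -[X in X + _](divfK b0) -[X in _ + X]mul1r -mulrDl.
  by apply: (vmaxMl _ mb); apply: (vringD Oab (vring1 vrO)).
rewrite invf_div => Oba.
rewrite -[X in _ + X](divfK a0) -[X in X + _]mul1r -mulrDl.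
by apply: (vmaxMl _ ma); apply: (vringD (vring1 vrO) Oba).
Qed.

Lemma vmaxN a : vmax O a -> vmax O (- a).
Proof.
by rewrite -mulN1r => ma; apply: (vmaxMl _ ma); apply: vringN; apply: (vring1 vrO).
Qed.

Lemma vmax1 : ~ vmax O 1.
Proof.
case/vmaxP=> _ [/eqP|]; first by rewrite oner_eq0.
by rewrite invr1; apply; apply: (vring1 vrO).
Qed.

Lemma vmax_prime a b : O a -> O b -> vmax O (a * b) -> vmax O a \/ vmax O b.
Proof.
move=> Oa Ob mab; apply: contrapT => /not_orP[na nb].
have inv z : O z -> ~ vmax O z -> z != 0 /\ O z^-1.
  move=> Oz nz; split.
    by apply/eqP=> z0; apply: nz; apply/vmaxP; split=> //; left.
  by apply: contrapT => nOV; apply: nz; apply/vmaxP; split=> //; right.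
have [a0 OVa] := inv _ Oa na; have [b0 OVb] := inv _ Ob nb.
apply: vmax1; rewrite -(mulVf (mulf_neq0 a0 b0)); apply: (vmaxMl _ mab).
by rewrite invfM; apply: (vringM vrO).
Qed.

Lemma vmax_expr a n : O a -> vmax O (a ^+ n) -> vmax O a.
Proof.
move=> Oa; elim: n => [|n IHn]; first by rewrite expr0 => /vmax1.
by rewrite exprS => /(vmax_prime Oa (vringX _ Oa))[|/IHn].
Qed.

(** If z were outside O, dividing the equation p(z) = 0 by a power of z would
    write 1 as a sum of elements of the maximal ideal. *)
Lemma vring_integral (p : {poly L}) z :
  p \is monic -> (forall i, O p`_i) -> root p z -> O z.
Proof.
move=> /monicP lp Op /rootP pz; case: (vring_total vrO z) => // OVz.
apply: contrapT => nOz.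
have z0 : z != 0 by apply/eqP=> z0; apply: nOz; rewrite z0; apply: vring0.
have mV : vmax O z^-1 by apply/vmaxP; split=> //; right; rewrite invrK.
have sp : size p = (size p).-1.+1.
  by rewrite prednK // lt0n size_poly_eq0 -lead_coef_eq0 lp oner_eq0.
apply: vmax1; set n := (size p).-1 in sp.
have pn : p`_n = 1 by rewrite -lp lead_coefE.
move: pz; rewrite horner_coef sp big_ord_recr /= pn mul1r => /eqP.
rewrite addrC addr_eq0 => /eqP zn.
rewrite -(divff (expf_neq0 n z0)) {1}zn mulNr mulr_suml.
apply: vmaxN; apply: big_ind; first by apply/vmaxP; split; [exact: vring0|left].
  exact: vmaxD.
move=> i _; rewrite -mulrA.
have -> : z ^+ i / z ^+ n = z^-1 ^+ (n - i).-1 * z^-1.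
  rewrite -exprSr prednK ?subn_gt0 // exprVn -[in z ^+ n](subnKC (ltnW (ltn_ord i))).
  by rewrite exprD invfM mulrA divff ?mul1r // expf_neq0.
by apply: vmaxMl => //; apply: (vmaxMl _ mV); apply: vringX.
Qed.

End ValuationRings.

Section Units.
Variables (L : fieldType) (O : set L).
Hypotheses (O1 : O 1) (OM : forall a b, O a -> O b -> O (a * b)).

Lemma vunits1 : vunits O 1.
Proof. by split; rewrite ?oner_eq0 ?invr1. Qed.

Lemma vunitsM a b : vunits O a -> vunits O b -> vunits O (a * b).
Proof.
case=> a0 Oa OVa [b0 Ob OVb]; split; [exact: mulf_neq0|exact: OM|].
by rewrite invfM; apply: OM.
Qed.

Lemma vunitsV a : vunits O a -> vunits O a^-1.
Proof. by case=> a0 Oa OVa; split; rewrite ?invr_eq0 ?invrK. Qed.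

Lemma vunitsXz a (n : int) : vunits O a -> vunits O (a ^ n).
Proof.
have pow b m : vunits O b -> vunits O (b ^+ m).
  by move=> Ub; elim: m => [|m IHm]; rewrite ?exprS; [exact: vunits1|exact: vunitsM].
move=> Ua; case: n => m /=; first exact: pow.
by apply: vunitsV; apply: pow.
Qed.

End Units.

(** * The places of the rational function field *)

Section RationalPlace.
Variables (k : fieldType) (P : {poly k}).
Hypothesis irrP : irreducible_poly P.

Lemma irreducible_dvdM (a b : {poly k}) :
  (P %| a * b) = (P %| a) || (P %| b).
Proof.
apply/idP/orP=> [Pab|[] h]; [|exact: dvdp_mulr|exact: dvdp_mull].
have [Pa|nPa] := boolP (P %| a); [by left|right].
by rewrite -(Gauss_dvdpr _ (_ : coprimep P a)) // irreducible_poly_coprime.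
Qed.

Lemma irreducible_neq0 : P != 0.
Proof. by rewrite -size_poly_gt0; apply: ltn_trans (irrP.1). Qed.

Lemma irreducible_ndvd1 : ~~ (P %| 1).
Proof. by rewrite dvdp1 neq_ltn irrP orbT. Qed.

Lemma irreducible_decomp (b : {poly k}) :
  b != 0 -> exists n b', ~~ (P %| b') /\ b = P ^+ n * b'.
Proof.
have [m] := ubnP (size b); elim: m b => // m IHm b sb b0.
have [/dvdpP[c def_b]|nPb] := boolP (P %| b); last first.
  by exists 0%N, b; rewrite expr0 mul1r.
have c0 : c != 0 by apply: contraNneq b0 => c0; rewrite def_b c0 mul0r.
have [|n [b' [nPb' def_c]]] := IHm c _ c0.
  move: sb; rewrite def_b size_mul ?irreducible_neq0 // -subn1.
  move: (irrP.1); case: (size P) => [|[|s]] // _.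
  by rewrite addnS subn1 /= addnS ltnS => /(leq_ltn_trans (leq_addr _ _)).
by exists n.+1, b'; split=> //; rewrite def_b def_c exprS mulrC mulrA.
Qed.

Lemma irreducible_inv_mod (b : {poly k}) :
  ~~ (P %| b) -> exists u, P %| u * b - 1.
Proof.
move=> nPb; have /Bezout_eq1_coprimepP[[u v] /= uv] : coprimep b P.
  by rewrite coprimep_sym irreducible_poly_coprime.
by exists u; apply/dvdpP; exists (- v); rewrite -uv opprD addrA subrr sub0r mulNr.
Qed.

End RationalPlace.

Section FinitePlace.
Variables (Fq : finFieldType) (P : {poly Fq}).
Hypothesis irrP : irreducible_poly P.

Local Notation OP := (finite_place P).

Lemma ndvd_tofrac_neq0 (g : {poly Fq}) : ~~ (P %| g) -> tofrac g != 0.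
Proof. by rewrite tofrac_eq0; apply: contraNneq => ->; rewrite dvdp0. Qed.

Lemma finite_place_frac (f g : {poly Fq}) :
  ~~ (P %| g) -> OP (tofrac f / tofrac g).
Proof. by move=> nPg; exists f, g. Qed.

Lemma finite_place_poly (f : {poly Fq}) : OP (tofrac f).
Proof.
by exists f, 1; split; rewrite ?irreducible_ndvd1 // rmorph1 divr1.
Qed.

Lemma finite_place1 : OP 1.
Proof. by rewrite -tofrac1; apply: finite_place_poly. Qed.

Lemma finite_placeM a b : OP a -> OP b -> OP (a * b).
Proof.
case=> [f [g [nPg ->]]] [f' [g' [nPg' ->]]].
rewrite mulf_div -!rmorphM; apply: finite_place_frac.
by rewrite irreducible_dvdM // negb_or nPg.
Qed.

Lemma vunits_finite_place (f g : {poly Fq}) :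
  ~~ (P %| f) -> ~~ (P %| g) -> vunits OP (tofrac f / tofrac g).
Proof.
move=> nPf nPg; split; last by rewrite invf_div; apply: finite_place_frac.
  by rewrite mulf_neq0 ?invr_eq0 ?ndvd_tofrac_neq0.
exact: finite_place_frac.
Qed.

Lemma vunits_finite_placeP u : vunits OP u ->
  exists f g : {poly Fq}, [/\ ~~ (P %| f), ~~ (P %| g) & u = tofrac f / tofrac g].
Proof.
case=> u0 [f [g [nPg def_u]]] [f' [g' [nPg' def_Vu]]].
have := divff u0; rewrite def_Vu def_u mulf_div -!rmorphM => /divr1_eq/eqP.
rewrite tofrac_eq => /eqP e; exists f, g; split=> //.
apply/negP=> /(dvdp_mulr f'); rewrite e irreducible_dvdM //.
by rewrite (negPf nPg) (negPf nPg').
Qed.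

Lemma vmax_finite_placeP z : vmax OP z <->
  exists f g : {poly Fq}, [/\ P %| f, ~~ (P %| g) & z = tofrac f / tofrac g].
Proof.
split=> [[[f [g [nPg def_z]]] nUz]|[f [g [Pf nPg ->]]]].
  exists f, g; split=> //; apply: contrapT => /negP nPf.
  by apply: nUz; rewrite def_z; apply: vunits_finite_place.
split; first exact: finite_place_frac.
case/vunits_finite_placeP=> f' [g' [nPf' nPg' /eqP]].
rewrite eqr_div ?ndvd_tofrac_neq0 // -!rmorphM tofrac_eq => /eqP e.
have := dvdp_mulr g' Pf; rewrite e irreducible_dvdM //.
by rewrite (negPf nPg) (negPf nPf').
Qed.

(** A polynomial represents each class of the residue field. *)
Lemma finite_place_residue c : OP c ->
  exists d : {poly Fq}, vmax OP (c - tofrac d).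
Proof.
case=> [f [g [nPg ->]]]; have [u Pu] := irreducible_inv_mod irrP nPg.
exists (u * f); apply/vmax_finite_placeP; exists (- ((u * g - 1) * f)), g.
split; rewrite ?dvdpNr ?dvdp_mulr //.
have g0 := ndvd_tofrac_neq0 nPg; apply: (mulIf g0).
by rewrite mulrBl !divfK // -rmorphM -rmorphB; congr tofrac; ring.
Qed.

Lemma vmax_finite_place_shift z (d : {poly Fq}) :
  P %| d -> vmax OP (z - tofrac d) -> vmax OP z.
Proof.
move=> Pd /vmax_finite_placeP[f [g [Pf nPg def_z]]].
apply/vmax_finite_placeP; exists (f + d * g), g.
rewrite dvdp_add ?dvdp_mulr //; split=> //.
rewrite -[LHS](subrK (tofrac d)) def_z rmorphD rmorphM mulrDl mulfK //.
exact: ndvd_tofrac_neq0.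
Qed.

Lemma vmax_prime_polynomial : vmax OP (tofrac P).
Proof.
apply/vmax_finite_placeP; exists P, 1.
by rewrite dvdpp irreducible_ndvd1 // rmorph1 divr1.
Qed.

(** Any two prime elements of the place P differ by a unit, so the valuation can
    be measured with P itself. *)
Lemma finite_place_valuation z n : has_valuation OP z n ->
  exists2 u, vunits OP u & z = u * tofrac P ^ n.
Proof.
case=> t [u [pt Uu ->]].
suff [w Uw ->]: exists2 w, vunits OP w & t = w * tofrac P.
  exists (u * w ^ n); last by rewrite expfzMl mulrA.
  apply: (vunitsM finite_placeM) => //.
  by apply: vunitsXz Uw; [exact: finite_place1|exact: finite_placeM].
have /vmax_finite_placeP[f [g [/dvdpP[f' ->] nPg def_t]]] : vmax OP t.
  by rewrite pt; exists 1; rewrite ?mulr1 //; apply: finite_place1.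
have : vmax OP (tofrac P) by exact: vmax_prime_polynomial.
rewrite pt => -[_ [f1 [g1 [nPg1 ->]]]] def_P.
exists (tofrac f' / tofrac g); last by rewrite def_t rmorphM mulrAC.
apply: vunits_finite_place => //; apply: contraNN nPg => Pf'.
have P0 : tofrac P != 0 by rewrite tofrac_eq0 irreducible_neq0.
have e :
    tofrac P * ((tofrac f' / tofrac g) * (tofrac f1 / tofrac g1)) = tofrac P.
  by rewrite -[RHS]def_P def_t rmorphM; ring.
move: e; rewrite -[RHS]mulr1 => /(mulfI P0).
rewrite mulf_div -!rmorphM => /divr1_eq/eqP; rewrite tofrac_eq => /eqP e.
by have := dvdp_mulr f1 Pf'; rewrite e irreducible_dvdM // (negPf nPg1) orbF.
Qed.

End FinitePlace.

(** * Localizing an order at a locally principal prime *)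

Section Embedding.
Variables (Fq : finFieldType) (F : fieldExtType {fraction {poly Fq}}).

Definition emb (g : {poly Fq}) : F := (tofrac g)%:A.

Lemma embE g : emb g = (tofrac g)%:A. Proof. by []. Qed.

Lemma emb_zmod_morphism : zmod_morphism emb.
Proof. by move=> a b; rewrite /emb rmorphB scalerBl. Qed.
HB.instance Definition _ :=
  GRing.isZmodMorphism.Build {poly Fq} F emb emb_zmod_morphism.

Lemma emb_monoid_morphism : monoid_morphism emb.
Proof.
by split=> [|a b]; rewrite /emb ?rmorph1 ?scale1r // rmorphM -scalerAl mul1r scalerA.
Qed.
HB.instance Definition _ :=
  GRing.isMonoidMorphism.Build {poly Fq} F emb emb_monoid_morphism.

Lemma embB : {morph emb : a b / a - b}. Proof. exact: rmorphB. Qed.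
Lemma embD : {morph emb : a b / a + b}. Proof. exact: rmorphD. Qed.
Lemma embM : {morph emb : a b / a * b}. Proof. exact: rmorphM. Qed.
Lemma embN : {morph emb : a / - a}. Proof. exact: rmorphN. Qed.
Lemma embX n : {morph emb : a / a ^+ n}. Proof. exact: rmorphXn. Qed.
Lemma emb0 : emb 0 = 0. Proof. exact: rmorph0. Qed.
Lemma emb1 : emb 1 = 1. Proof. exact: rmorph1. Qed.

Lemma emb_eq0 g : (emb g == 0) = (g == 0).
Proof. by rewrite /emb scaler_eq0 oner_eq0 orbF tofrac_eq0. Qed.

Lemma emb_inj : injective emb.
Proof. by move=> a b /eqP; rewrite -subr_eq0 -rmorphB emb_eq0 subr_eq0 => /eqP. Qed.

Lemma alg_exprz (a : {fraction {poly Fq}}) (n : int) : (a ^ n)%:A = a%:A ^ n :> F.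
Proof. exact: (fmorphXz (in_alg F) n a). Qed.

End Embedding.
Arguments emb {Fq} F g.

Section Orders.
Variables (Fq : finFieldType) (F : fieldExtType {fraction {poly Fq}}).
Variable P : {poly Fq}.

Local Notation emb := (emb F).

(** Integrality of R at P is expressed by the inclusion in every place above P,
    the form in which it is used. *)
Record order_above (R : set F) : Prop := OrderAbove {
  order_emb : forall g, R (emb g);
  orderB : forall a b, R a -> R b -> R (a - b);
  orderM : forall a b, R a -> R b -> R (a * b);
  order_frac : forall z, exists2 b, b != 0 & R (emb b * z);
  order_integral : forall O, place_above P O -> R `<=` O
}.

(** M is a maximal ideal of R above P. It need not be principal: pi generates it
    after inverting s, and P equals pi ^ e up to the unit s'' / s' of R_M. Since
    R / M is the residue field of R_M, its dimension f over Fq[x] / (P) is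
    tested with polynomial coefficients. *)
Record uniformized_prime (R M : set F) (e f : nat) : Prop := UniformizedPrime {
  prime_sub : M `<=` R;
  primeB : forall a b, M a -> M b -> M (a - b);
  primeMl : forall a b, R a -> M b -> M (a * b);
  prime_proper : ~ M 1;
  prime_inv_mod : forall a, R a -> ~ M a -> exists2 b, R b & M (a * b - 1);
  prime_above : M (emb P);
  prime_unif : exists pi s, [/\ M pi, R s, ~ M s,
    forall a, M a -> exists2 b, R b & s * a = pi * b
    & exists s' s'', [/\ R s', ~ M s', R s'', ~ M s''
                      & s' * emb P = s'' * pi ^+ e]];
  prime_residue : exists b : 'I_f -> F, [/\ forall i, R (b i),
    forall c : 'I_f -> {poly Fq}, M (\sum_i emb (c i) * b i) ->
      forall i, P %| c i
    & forall r, R r -> exists c : 'I_f -> {poly Fq},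
        M (r - \sum_i emb (c i) * b i)]
}.

Definition localization (R M : set F) : set F :=
  [set z | exists a b, [/\ R a, R b, ~ M b & z = a / b]].

Section Localization.
Variables (R M : set F) (e f : nat).
Hypotheses (irrP : irreducible_poly P) (orderR : order_above R).
Hypothesis (primeM : uniformized_prime R M e f).

Local Notation OM := (localization R M).

Lemma order1 : R 1.
Proof. by rewrite -(rmorph1 emb); apply: order_emb orderR 1. Qed.

Lemma order0 : R 0.
Proof. by rewrite -(rmorph0 emb); apply: (order_emb orderR). Qed.

Lemma orderD a b : R a -> R b -> R (a + b).
Proof.
move=> Ra Rb; have -> : a + b = a - (0 - b) by rewrite sub0r opprK.
exact: (orderB orderR Ra (orderB orderR order0 Rb)).
Qed.

Lemma orderX a n : R a -> R (a ^+ n).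
Proof.
move=> Ra; elim: n => [|n IHn]; first exact: order1.
by rewrite exprS; apply: (orderM orderR).
Qed.

Lemma order_sum (I : Type) (r : seq I) (E : I -> F) :
  (forall i, R (E i)) -> R (\sum_(i <- r) E i).
Proof. by move=> RE; apply: big_ind => //; [apply: order0|apply: orderD]. Qed.

Lemma prime0 : M 0.
Proof. by rewrite -(subrr (emb P)); apply: (primeB primeM); apply: (prime_above primeM). Qed.

Lemma nprime_neq0 a : ~ M a -> a != 0.
Proof. by move=> nMa; apply/eqP=> a0; apply: nMa; rewrite a0; apply: prime0. Qed.

Lemma nprimeM a b : R a -> R b -> ~ M a -> ~ M b -> ~ M (a * b).
Proof.
move=> Ra Rb nMa nMb Mab; have [a' Ra' Ma'] := prime_inv_mod primeM Ra nMa.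
apply: nMb; have -> : b = a' * (a * b) - b * (a * a' - 1) by ring.
by apply: (primeB primeM); apply: (primeMl primeM).
Qed.

Lemma nprimeX a n : R a -> ~ M a -> ~ M (a ^+ n).
Proof.
move=> Ra nMa; elim: n => [|n IHn]; first exact: (prime_proper primeM).
by rewrite exprS; apply: nprimeM => //; apply: orderX.
Qed.

Lemma prime_emb g : M (emb g) <-> P %| g.
Proof.
split=> [Mg|/dvdpP[h ->]]; last first.
  rewrite rmorphM.
  exact: (primeMl primeM (order_emb orderR h) (prime_above primeM)).
apply: contrapT => /negP /(irreducible_inv_mod irrP)[u /dvdpP[v uv]].
apply: (prime_proper primeM).
have -> : 1 = emb u * emb g - emb v * emb P.
  by rewrite -!rmorphM -rmorphB -uv opprB addrC subrK rmorph1.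
apply: (primeB primeM); apply: (primeMl primeM) => //; try exact: (order_emb orderR).
exact: (prime_above primeM).
Qed.

Lemma localization_frac a b : R a -> R b -> ~ M b -> OM (a / b).
Proof. by move=> Ra Rb nMb; exists a, b. Qed.

Lemma localization_order a : R a -> OM a.
Proof.
move=> Ra; exists a, 1; rewrite divr1; split=> //; first exact: order1.
exact: (prime_proper primeM).
Qed.

Lemma localizationB a b : OM a -> OM b -> OM (a - b).
Proof.
case=> [x [y [Rx Ry nMy ->]]] [x' [y' [Rx' Ry' nMy' ->]]].
rewrite -mulNr addf_div ?nprime_neq0 // mulNr.
apply: localization_frac; [apply: (orderB orderR)| |exact: nprimeM];
  exact: (orderM orderR).
Qed.

Lemma localizationM a b : OM a -> OM b -> OM (a * b).
Proof.
case=> [x [y [Rx Ry nMy ->]]] [x' [y' [Rx' Ry' nMy' ->]]].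
rewrite mulf_div; apply: localization_frac; last exact: nprimeM;
  exact: (orderM orderR).
Qed.

Lemma vunits_localization a b :
  R a -> R b -> ~ M a -> ~ M b -> vunits OM (a / b).
Proof.
move=> Ra Rb nMa nMb; split; first by rewrite mulf_neq0 ?invr_eq0 ?nprime_neq0.
  exact: localization_frac.
by rewrite invf_div; apply: localization_frac.
Qed.

Lemma vmax_localizationP z : vmax OM z <->
  exists a b, [/\ M a, R b, ~ M b & z = a / b].
Proof.
split=> [[[a [b [Ra Rb nMb def_z]]] nUz]|[a [b [Ma Rb nMb ->]]]].
  exists a, b; split=> //; apply: contrapT => nMa; apply: nUz.
  by rewrite def_z; apply: vunits_localization.
split; first by apply: localization_frac => //; apply: (prime_sub primeM).
case=> ab0 _; rewrite invf_div => -[c [d [Rc Rd nMd /eqP]]].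
have a0 : a != 0 by apply: contraNneq ab0 => ->; rewrite mul0r.
rewrite eqr_div ?(nprime_neq0 nMd) // => /eqP bd.
by apply: (nprimeM Rb Rd nMb nMd); rewrite bd; apply: (primeMl primeM).
Qed.

Lemma vmax_localization a : R a -> vmax OM a <-> M a.
Proof.
move=> Ra; split=> [/vmax_localizationP[c [b [Mc Rb nMb def_a]]]|Ma].
  apply: contrapT => nMa; apply: (nprimeM Ra Rb nMa nMb).
  by rewrite def_a divfK ?nprime_neq0.
apply/vmax_localizationP; exists a, 1; rewrite divr1; split=> //.
  exact: order1.
exact: (prime_proper primeM).
Qed.

Lemma localization1 : OM 1.
Proof. exact: localization_order order1. Qed.

Lemma emb_prime_neq0 : emb P != 0.
Proof. by rewrite emb_eq0 irreducible_neq0. Qed.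

(** Every nonzero a in R divides a nonzero polynomial, whose P-part is a power
    of the uniformizer up to elements outside M; this bounds how often the
    uniformizer can be split off from a. *)
Lemma localization_uniformizer : exists pi,
  [/\ prime_element OM pi, pi != 0,
      exists2 u, vunits OM u & emb P = u * pi ^+ e
    & forall z, z != 0 -> exists2 u, vunits OM u & exists n : int, z = u * pi ^ n].
Proof.
have [pi [s [Mpi Rs nMs piP [s' [s'' [Rs' nMs' Rs'' nMs'' Ps]]]]]] :=
  prime_unif primeM.
have Rpi := prime_sub primeM Mpi.
have pi0 : pi != 0.
  apply/eqP=> pi0; have [b _] := piP _ (prime_above primeM).
  rewrite pi0 mul0r => /eqP; rewrite mulf_eq0 (negPf (nprime_neq0 nMs)).
  by rewrite (negPf emb_prime_neq0).
have unit_order a : R a -> ~ M a ->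
    exists2 u, vunits OM u & exists m : int, a = u * pi ^ m.
  move=> Ra nMa; exists (a / 1); last by exists 0; rewrite divr1 expr0z mulr1.
  by apply: vunits_localization => //; [exact: order1|exact: (prime_proper primeM)].
have split_off n a r w : R a -> R r -> R w -> ~ M w -> a * r = w * pi ^+ n ->
    exists2 u, vunits OM u & exists m : int, a = u * pi ^ m.
  elim: n a r w => [|n IHn] a r w Ra Rr Rw nMw def_w;
    (have [Ma|nMa] := pselect (M a); last exact: unit_order).
    case: nMw; rewrite -[w]mulr1 -(expr0 pi) -def_w mulrC.
    exact: (primeMl primeM).
  have [a' Ra' def_a'] := piP a Ma.
  have [|u Uu [m def_m]] :=
    IHn a' r (s * w) Ra' Rr (orderM orderR Rs Rw) (nprimeM Rs Rw nMs nMw).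
    apply: (mulfI pi0); transitivity (s * (a * r)).
      by rewrite [RHS]mulrA def_a' mulrA.
    by rewrite def_w exprS; ring.
  exists (u * (1 / s)).
    apply: (vunitsM localizationM) Uu _; apply: vunits_localization => //.
      exact: order1.
    exact: (prime_proper primeM).
  exists (m + 1); rewrite expfzDr // expr1z; apply: (mulfI (nprime_neq0 nMs)).
  rewrite def_a' def_m; have := nprime_neq0 nMs => s0; field.
  exact: s0.
have pow_order a : R a -> a != 0 ->
    exists2 u, vunits OM u & exists m : int, a = u * pi ^ m.
  move=> Ra a0; have [b b0 Rb] := order_frac orderR a^-1.
  have [k [b' [nPb' def_b]]] := irreducible_decomp irrP b0.
  apply: (split_off (e * k)%N _ (s' ^+ k * (emb b * a^-1)) (s'' ^+ k * emb b')) => //.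
  - exact: (orderM orderR (orderX _ Rs') Rb).
  - exact: (orderM orderR (orderX _ Rs'') (order_emb orderR _)).
  - apply: nprimeM; [exact: orderX|exact: (order_emb orderR)|exact: nprimeX|].
    by move/prime_emb; apply/negP.
  rewrite mulrCA [a * _]mulrCA divff // mulr1 def_b rmorphM rmorphXn mulrA.
  by rewrite -exprMn Ps exprMn -exprM mulrAC.
exists pi; split=> //.
- apply/seteqP; split=> z.
    case/vmax_localizationP=> a [b [Ma Rb nMb ->]].
    have [c Rc def_c] := piP a Ma; exists (c / (s * b)).
      by apply: localization_frac Rc (orderM orderR Rs Rb) (nprimeM Rs Rb nMs nMb).
    rewrite mulrA -def_c -mulf_div divff ?mul1r //; exact: nprime_neq0.
  case=> _ [a [b [Ra Rb nMb ->]]] <-; apply/vmax_localizationP.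
  exists (a * pi), b; split=> //; first exact: (primeMl primeM).
  by rewrite mulrA [a * _]mulrC.
- exists (s'' / s'); first exact: vunits_localization.
  apply: (mulfI (nprime_neq0 nMs')); rewrite Ps [RHS]mulrA.
  by rewrite [s' * (_ / _)]mulrC divfK ?nprime_neq0.
move=> z z0; have [b b0 Rbz] := order_frac orderR z.
have eb0 : emb b != 0 by rewrite emb_eq0.
have [u Uu [m def_m]] := pow_order _ Rbz (mulf_neq0 eb0 z0).
have [v Uv [n def_n]] := pow_order _ (order_emb orderR b) eb0.
exists (u * v^-1); first by apply: (vunitsM localizationM) => //; apply: vunitsV.
exists (m - n); rewrite expfzDr // -invr_expz mulrACA -invfM -def_m -def_n.
by rewrite mulrAC divff ?mul1r.
Qed.

Lemma localization_place : place_above P OM.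
Proof.
have [pi [pi_prime pi0 _ piP]] := localization_uniformizer.
have OMe g : OM (emb g) by apply: localization_order; apply: (order_emb orderR).
split; last first.
  move=> z /(vmax_finite_placeP irrP)[g [h [Pg nPh ->]]].
  apply/vmax_localizationP; exists (emb g), (emb h); split.
  - exact/prime_emb.
  - exact: (order_emb orderR).
  - by move/prime_emb; apply/negP.
  apply: (mulIf (_ : emb h != 0)).
    by rewrite emb_eq0; apply: contraNneq nPh => ->; rewrite dvdp0.
  rewrite divfK; last first.
    by rewrite emb_eq0; apply: contraNneq nPh => ->; rewrite dvdp0.
  by rewrite !embE -scalerAl mul1r scalerA divfK ?(ndvd_tofrac_neq0 nPh).
split.
- exact: localization1.
- exact: localizationB.
- exact: localizationM.
- split=> [_ [c _ <-]|]; first exact: OMe.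
  move/(_ _ (OMe P)) => [c _ /(@emb_inj _ F) cP].
  by have := irrP.1; rewrite -cP size_polyC; case: (c != 0).
- split=> // /(_ (emb P)^-1 I) OVP.
  have [_ ] : vmax OM (emb P).
    by apply/vmax_localization; [exact: (order_emb orderR)|exact: (prime_above primeM)].
  by apply; split=> //; apply: emb_prime_neq0.
move=> z; have [->|z0] := eqVneq z 0; first by left; apply: localization_order order0.
have Opi n : OM (pi ^+ n).
  have [] : vmax OM pi by rewrite pi_prime; exists 1; rewrite ?mulr1 //; apply: localization1.
  move=> Opi _; elim: n => [|n IHn]; first exact: localization1.
  by rewrite exprS; apply: localizationM.
have [u [_ Ou OVu] [[n|n] ->]] := piP z z0; [left|right].
  exact: (localizationM Ou (Opi n)).
by rewrite NegzE -exprnN invfM invrK; apply: (localizationM OVu (Opi _)).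
Qed.

Lemma localization_ramification : ramification_index (finite_place P) OM e.
Proof.
have [pi [pi_prime pi0 [u Uu def_P] _]] := localization_uniformizer.
move=> z n /(finite_place_valuation irrP)[w /(vunits_finite_placeP irrP)].
case=> [g [h [nPg nPh ->]]] ->.
exists pi, (emb g / emb h * u ^ n); split=> //.
  apply: (vunitsM localizationM); last first.
    by apply: vunitsXz => //; [exact: localization1|exact: localizationM].
  by apply: vunits_localization; try exact: (order_emb orderR);
    move/prime_emb; apply/negP.
have embV a : (a^-1)%:A = (a%:A)^-1 :> F := fmorphV (in_alg F) a.
have algM a b : (a * b)%:A = a%:A * b%:A :> F := rmorphM (in_alg F) a b.
rewrite !algM embV alg_exprz -[(tofrac P)%:A]/(emb P) def_P.
by rewrite expfzMl exprnP exprz_exp mulrA.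
Qed.

Lemma localization_residue_degree : residue_degree (finite_place P) OM f.
Proof.
have [b [Rb b_free b_span]] := prime_residue primeM.
have [vrO lies] := localization_place.
exists b; split=> [i|c Oc mc i|z].
- exact: localization_order.
- have /fin_all_exists[d md] j :
      exists d : {poly Fq}, vmax (finite_place P) (c j - tofrac d).
    exact: (finite_place_residue irrP (Oc j)).
  have Pd j : P %| d j.
    apply: b_free; apply/vmax_localization.
      by apply: order_sum => k; apply: (orderM orderR) => //; apply: (order_emb orderR).
    rewrite -[X in vmax _ X](subrK (\sum_i c i *: b i)) addrC -sumrB.
    apply: (vmaxD vrO mc); apply: big_ind; [|exact: (vmaxD vrO)|move=> k _].
      by apply/vmax_localization; [exact: order0|exact: prime0].
    have -> : emb (d k) * b k - c k *: b k = - (b k * (c k - tofrac (d k))%:A).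
      by rewrite -[c k *: _]mulr_algl scalerBl !embE; ring.
    apply: (vmaxN vrO); apply: (vmaxMl vrO); last exact: lies.
    exact: localization_order.
  exact: (vmax_finite_place_shift irrP (Pd i) (md i)).
case=> x [y [Rx Ry nMy ->]].
have [y' Ry' My'] := prime_inv_mod primeM Ry nMy.
have [c Mc] := b_span _ (orderM orderR Rx Ry').
exists (fun i => tofrac (c i)) => [i|]; first exact: (finite_place_poly irrP).
have -> : x / y - \sum_i tofrac (c i) *: b i =
    (x * y' - \sum_i emb (c i) * b i) - x * (y * y' - 1) / y.
  rewrite mulrBr mulr1 mulrBl mulrCA -[y * _ / y]mulrAC divff ?nprime_neq0 // mul1r.
  under eq_bigr do rewrite -mulr_algl.
  by rewrite opprB [RHS]addrC addrA subrK.
apply: (vmaxD vrO).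
  apply/vmax_localization => //; exact: (prime_sub primeM).
apply: (vmaxN vrO); apply/vmax_localizationP; exists (x * (y * y' - 1)), y.
by split=> //; apply: (primeMl primeM).
Qed.

(** A discrete valuation ring is a maximal proper subring: an element z of O
    outside R_M would have its inverse in the maximal ideal of R_M, which is
    contained in that of O. *)
Lemma localization_unique O : place_above P O -> M `<=` vmax O -> O = OM.
Proof.
move=> aboveO sMO; have [vrO _] := aboveO.
have sRO := order_integral orderR aboveO.
have unitO a : R a -> ~ M a -> a != 0 /\ O a^-1.
  move=> Ra nMa; have a0 := nprime_neq0 nMa; split=> //.
  apply: contrapT => nOVa; have [b Rb Mab] := prime_inv_mod primeM Ra nMa.
  apply: (vmax1 vrO); have -> : 1 = b * a - (a * b - 1) by ring.
  apply: (vmaxD vrO); last by apply: (vmaxN vrO); apply: sMO.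
  apply: (vmaxMl vrO); first exact: sRO.
  by apply/vmaxP; split; [exact: sRO|right].
apply/seteqP; split=> [z Oz|_ [a [b [Ra Rb nMb ->]]]]; last first.
  have [_ OVb] := unitO b Rb nMb; apply: (vringM vrO) OVb; exact: sRO.
have [vrM _] := localization_place; apply: contrapT => nOMz.
have [//|OMVz] := vring_total vrM z.
have z0 : z != 0 by apply/eqP=> z0; apply: nOMz; rewrite z0; apply: (vring0 vrM).
have /vmax_localizationP[a [b [Ma Rb nMb def_Vz]]] : vmax OM z^-1.
  by apply/vmaxP; split=> //; right; rewrite invrK.
apply: (vmax1 vrO); rewrite -(divff z0) def_Vz mulrCA.
have [_ OVb] := unitO b Rb nMb.
rewrite mulrC; apply: (vmaxMl vrO); last exact: sMO.
exact: (vringM vrO).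
Qed.

End Localization.

(** By localization_unique, places above P correspond to primes of R; since the
    maximal ideal of R_M meets R in M, distinct primes give distinct places. *)
Lemma signature_of_primes (R : set F) (m : nat) (ef : m.-tuple (nat *l nat))
    (M : 'I_m -> set F) :
  irreducible_poly P -> order_above R -> sorted <=%O ef -> injective M ->
  (forall i, uniformized_prime R (M i) (tnth ef i).1 (tnth ef i).2) ->
  (forall O, place_above P O -> exists i, M i `<=` vmax O) ->
  is_signature F P (flatten [seq [:: p.1; p.2] | p <- ef]).
Proof.
move=> irrP orderR sorted_ef injM primeM coverM.
exists m, ef, (fun i => localization R (M i)); split=> //.
- split=> [i j eq_loc|].
    apply: injM; apply/seteqP; split=> a Ma.
      have Ra := prime_sub (primeM i) Ma.
      apply/(vmax_localization orderR (primeM j) Ra); rewrite -eq_loc.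
      exact/(vmax_localization orderR (primeM i) Ra).
    have Ra := prime_sub (primeM j) Ma.
    apply/(vmax_localization orderR (primeM i) Ra); rewrite eq_loc.
    exact/(vmax_localization orderR (primeM j) Ra).
  apply/seteqP; split=> [_ [i _ <-]|O aboveO].
    exact: (localization_place irrP orderR (primeM i)).
  have [i sMO] := coverM O aboveO; exists i => //.
  by rewrite (localization_unique irrP orderR (primeM i) aboveO sMO).
- by move=> i; apply: (localization_ramification irrP orderR (primeM i)).
- by move=> i; apply: (localization_residue_degree irrP orderR (primeM i)).
Qed.

End Orders.

(** * Reduction modulo P *)

Lemma coef_sum_monomials (R : nzRingType) n (d : 'I_n -> R) (j : 'I_n) :
  (\sum_i (d i)%:P * 'X^i)`_j = d j.
Proof.
rewrite coef_sum (bigD1 j) //= coefCM coefXn eqxx mulr1 big1 ?addr0 // => i ij.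
by rewrite coefCM coefXn eq_sym val_eqE (negPf ij) mulr0.
Qed.

Lemma size_sum_monomials (R : nzRingType) n (d : 'I_n -> R) :
  (size (\sum_i (d i)%:P * 'X^i)%R <= n)%N.
Proof.
apply/leq_sizeP=> j nj; rewrite coef_sum big1 // => i _.
by rewrite coefCM coefXn gtn_eqF ?mulr0 // (leq_trans (ltn_ord i)).
Qed.

Section Reduction.
Variables (Fq : finFieldType) (P : {poly Fq}) (hP : monic_irreducible_poly P).

Local Notation kP := {poly %/ P with hP}.

Lemma modP_zmod_morphism : zmod_morphism (modP hP).
Proof. by move=> a b; apply: (rmorphB (in_qpoly P)). Qed.
HB.instance Definition _ :=
  GRing.isZmodMorphism.Build {poly Fq} kP (modP hP) modP_zmod_morphism.

Lemma modP_monoid_morphism : monoid_morphism (modP hP).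
Proof. by split=> [|a b]; [exact: in_qpoly1|exact: in_qpolyM]. Qed.
HB.instance Definition _ :=
  GRing.isMonoidMorphism.Build {poly Fq} kP (modP hP) modP_monoid_morphism.

Lemma modP_eq0 g : (modP hP g == 0) = (P %| g).
Proof.
by rewrite -val_eqE /= -Pdiv.IdomainMonic.modpE ?mk_monicE //; exact: hP.2.
Qed.

Definition liftP (t : kP) : {poly Fq} := val (t : {poly %/ P}).

Lemma liftPK : cancel liftP (modP hP).
Proof. by move=> t; apply: val_inj; apply: in_qpoly_small; apply: size_mk_monic. Qed.

Definition red (p : {poly {poly Fq}}) : {poly kP} := map_poly (modP hP) p.
HB.instance Definition _ := GRing.RMorphism.copy red (map_poly (modP hP)).

Lemma redD p q : red (p + q) = red p + red q.
Proof. exact: raddfD. Qed.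

Lemma redB p q : red (p - q) = red p - red q.
Proof. exact: raddfB. Qed.

Lemma redM p q : red (p * q) = red p * red q.
Proof. exact: rmorphM. Qed.

Lemma red1 : red 1 = 1.
Proof. exact: rmorph1. Qed.

Lemma redC g : red g%:P = (modP hP g)%:P.
Proof. exact: map_polyC. Qed.

Definition lift_red (r : {poly kP}) : {poly {poly Fq}} := map_poly liftP r.

Lemma lift_redK : cancel lift_red red.
Proof. by move=> r; apply/polyP=> i; rewrite coef_map coef_map_id0 //= liftPK. Qed.

Lemma red_eq0 p : red p = 0 -> exists q, p = P%:P * q.
Proof.
move=> rp0; exists (\poly_(i < size p) (p`_i %/ P)); apply/polyP=> i.
rewrite coefCM coef_poly; case: ltnP => [_|/(nth_default 0)->]; last by rewrite mulr0.
by rewrite mulrC divpK // -modP_eq0 -coef_map -/(red p) rp0 coef0.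
Qed.

End Reduction.

(** * Orders generated by one element *)

Section Evaluation.
Variables (Fq : finFieldType) (F : fieldExtType {fraction {poly Fq}}) (y : F).

Local Notation emb := (emb F).

Definition ev (p : {poly {poly Fq}}) : F := (map_poly emb p).[y].

Lemma ev_zmod_morphism : zmod_morphism ev.
Proof. by move=> a b; rewrite /ev rmorphB hornerD hornerN. Qed.
HB.instance Definition _ :=
  GRing.isZmodMorphism.Build {poly {poly Fq}} F ev ev_zmod_morphism.

Lemma ev_monoid_morphism : monoid_morphism ev.
Proof. by split=> [|a b]; rewrite /ev ?rmorph1 ?hornerC // rmorphM hornerM. Qed.
HB.instance Definition _ :=
  GRing.isMonoidMorphism.Build {poly {poly Fq}} F ev ev_monoid_morphism.

Lemma evB p q : ev (p - q) = ev p - ev q.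
Proof. exact: ev_zmod_morphism. Qed.

Lemma ev1 : ev 1 = 1.
Proof. exact: (ev_monoid_morphism.1). Qed.

Lemma evM p q : ev (p * q) = ev p * ev q.
Proof. exact: (ev_monoid_morphism.2). Qed.

Lemma evD p q : ev (p + q) = ev p + ev q.
Proof. exact: raddfD. Qed.

Lemma evC g : ev g%:P = emb g.
Proof. by rewrite /ev map_polyC hornerC. Qed.

Lemma evX : ev 'X = y.
Proof. by rewrite /ev map_polyX hornerX. Qed.

Lemma ev_frac p : ev p = (map_poly (in_alg F) (map_poly (@tofrac _) p)).[y].
Proof. by rewrite /ev -map_poly_comp. Qed.

End Evaluation.

Lemma fracP (R : idomainType) (z : {fraction R}) :
  exists n d : R, d != 0 /\ z = tofrac n / tofrac d.
Proof.
elim/quotW: z => r; exists (\n_r), (\d_r).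
have d0 := denom_ratioP r; split=> //.
apply: (canRL (mulfK _)); first by rewrite tofrac_eq0.
unlock FracField.tofrac; rewrite -[LHS]FracField.pi_mul; apply/eqmodP => /=.
by rewrite FracField.equivfE /FracField.mulf !numden_Ratio ?mulr1 ?oner_neq0 1?mulrC.
Qed.

Lemma clear_denominators (R : idomainType) (p : {poly {fraction R}}) :
  exists b q, b != 0 /\ tofrac b *: p = map_poly (@tofrac R) q.
Proof.
elim/poly_ind: p => [|p c [b [q [b0 bp]]]].
  by exists 1, 0; rewrite oner_neq0 scaler0 rmorph0.
have [n [d [d0 def_c]]] := fracP c.
have dc : tofrac n = tofrac d * c by rewrite def_c mulrC divfK ?tofrac_eq0.
exists (b * d), (d%:P * q * 'X + (b * n)%:P).
split; first exact: mulf_neq0.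
rewrite rmorphD !rmorphM /= map_polyX !map_polyC /= -bp -!mul_polyC dc.
by rewrite !polyCM; ring.
Qed.

Section Generated.
Variables (Fq : finFieldType) (F : fieldExtType {fraction {poly Fq}}).
Variables (P : {poly Fq}) (hP : monic_irreducible_poly P).

Local Notation emb := (emb F).
Local Notation kP := {poly %/ P with hP}.

Let irrP : irreducible_poly P := hP.1.

(** The variable is a root of the monic polynomial P(T) - P(x), whose
    coefficients are constants or multiples of P(x). *)
Lemma place_emb O g : place_above P O -> O (emb g).
Proof.
move=> [vrO lies].
have Oc c : O (emb c%:P) by have [sub _] := vring_constants vrO; apply: sub; exists c.
have OP : O (emb P) by apply: vmax_sub (lies _ (vmax_prime_polynomial irrP)).
pose ec := @polyC Fq; pose up (p : {poly Fq}) := map_poly emb (map_poly ec p).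
have up_coef p i : O (up p)`_i by rewrite !coef_map; apply: Oc.
have up_eval p : (up p).[emb 'X] = emb p.
  by rewrite horner_map -/(comp_poly 'X p) comp_polyXr.
have Ox : O (emb 'X).
  apply: (@vring_integral _ _ _ vrO (up P - (emb P)%:P)).
  - have monic_up : up P \is monic by rewrite !monic_map ?hP.
    rewrite monicE lead_coefDl -?monicE // size_polyN size_polyC.
    rewrite !size_map_inj_poly ?rmorph0 //; [|exact: polyC_inj|exact: emb_inj].
    exact: leq_ltn_trans (leq_b1 _) irrP.1.
  - move=> i; rewrite coefB coefC; apply: (vringB vrO (up_coef _ _)).
    by case: (i == 0%N) => //; apply: (vring0 vrO).
  - by rewrite rootE hornerD hornerN hornerC up_eval subrr.
rewrite -(up_eval g) horner_coef; apply: (vring_sum vrO) => i _.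
exact: (vringM vrO (up_coef _ _) (vringX vrO _ Ox)).
Qed.

Variables (f : {poly {poly Fq}}) (y : F).
Hypotheses (monic_f : f \is monic)
  (irr_f : irreducible_poly (map_poly (@tofrac _) f))
  (fy0 : ev y f = 0)
  (gen_y : forall z : F, exists p : {poly {fraction {poly Fq}}},
             z = (map_poly (in_alg F) p).[y]).

Local Notation ev := (ev y).

(** A nonzero polynomial of smaller degree is coprime to the irreducible f, so
    it does not vanish at y. *)
Lemma ev_eq0 (p : {poly {poly Fq}}) : (size p < size f)%N -> ev p = 0 -> p = 0.
Proof.
move=> ltpf evp; apply/eqP/negPn/negP=> p0.
pose fK := map_poly (@tofrac _) f; pose pK := map_poly (@tofrac _) p.
have sz r : size (map_poly (@tofrac {poly Fq}) r) = size r.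
  apply: size_map_inj_poly; last exact: tofrac0.
  by move=> a b /eqP; rewrite tofrac_eq => /eqP.
have pK0 : pK != 0 by rewrite -size_poly_eq0 sz size_poly_eq0.
have /Bezout_eq1_coprimepP[[u v] /= uv] : coprimep fK pK.
  rewrite irreducible_poly_coprime //; apply/negP=> /(dvdp_leq pK0).
  by rewrite !sz leqNgt ltpf.
have := congr1 (fun r => (map_poly (in_alg F) r).[y]) uv.
rewrite rmorphD !rmorphM rmorph1 !hornerE -!ev_frac fy0 evp !mulr0 addr0 => /eqP.
by rewrite eq_sym oner_eq0.
Qed.

Lemma ev_dvd p : ev p = 0 -> exists q, p = q * f.
Proof.
move=> evp; exists (Pdiv.Ring.rdivp p f).
have e := Pdiv.RingMonic.rdivp_eq monic_f p.
rewrite [LHS]e (_ : Pdiv.Ring.rmodp p f = 0) ?addr0 //.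
apply: ev_eq0; first by rewrite Pdiv.Ring.ltn_rmodp monic_neq0.
by move: evp; rewrite {1}e evD evM fy0 mulr0 add0r.
Qed.

Lemma place_ev O p : place_above P O -> O (ev p).
Proof.
move=> aboveO; have [vrO _] := aboveO.
have Oemb (r : {poly {poly Fq}}) i : O (map_poly emb r)`_i.
  by rewrite coef_map; apply: place_emb.
have Oy : O y.
  apply: (@vring_integral _ _ _ vrO (map_poly emb f)) => //; first exact: monic_map.
    by move=> i; apply: Oemb.
  by rewrite rootE -[_.[y]]/(ev f) fy0.
rewrite [X in O X](horner_coef (map_poly emb p) y); apply: (vring_sum vrO) => i _.
exact: (vringM vrO (Oemb _ _) (vringX vrO _ Oy)).
Qed.

Lemma generated_order : order_above P (range ev).
Proof.
split.
- by move=> g; exists g%:P; rewrite ?evC.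
- by move=> _ _ [p _ <-] [q _ <-]; exists (p - q); [|exact: evB].
- by move=> _ _ [p _ <-] [q _ <-]; exists (p * q); [|exact: evM].
- move=> z; have [p ->] := gen_y z.
  have [b [q [b0 bq]]] := clear_denominators p.
  exists b => //; exists q => //.
  by rewrite ev_frac -bq -mul_polyC rmorphM /= map_polyC hornerM hornerC.
- by move=> O aboveO _ [p _ <-]; apply: place_ev.
Qed.

(** * Places above a prime modulo which f is squarefree *)

Section KummerPrime.
Variables g h : {poly kP}.
Hypotheses (irr_g : irreducible_poly g) (coprime_gh : coprimep g h)
  (red_f : red hP f = g * h).

(** The ideal (P, g'(y)) of Fq[x][y]. *)
Definition kummer_prime (g' : {poly kP}) : set F :=
  [set z | exists2 p, g' %| red hP p & z = ev p].

Lemma kummer_prime_ev p : kummer_prime g (ev p) <-> g %| red hP p.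
Proof.
split=> [[q gq evpq]|gp]; last by exists p.
have /ev_dvd[r pq] : ev (p - q) = 0 by rewrite evB evpq subrr.
rewrite -(subrK q p) pq redD redM red_f.
by rewrite dvdp_add // dvdp_mull // dvdp_mulr.
Qed.

(** The cofactor h(y) lies outside M because h is coprime to g, and it maps
    M = (P, g(y)) into P R because g h = f = 0 modulo P at y; thus P
    itself is a uniformizer. *)
Lemma kummer_uniformized :
  uniformized_prime P (range ev) (kummer_prime g) 1 (size g).-1.
Proof.
have MP : kummer_prime g (emb P).
  exists P%:P; last by rewrite evC.
  by rewrite redC (eqP (_ : modP hP P == 0)) ?modP_eq0 // polyC0 dvdp0.
split=> //.
- by move=> _ [p _ ->]; exists p.
- move=> _ _ [p gp ->] [q gq ->]; exists (p - q); last by rewrite evB.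
  by rewrite redB dvdp_sub.
- move=> _ _ [p _ <-] [q gq ->]; exists (p * q); last by rewrite evM.
  by rewrite redM dvdp_mull.
- rewrite -(ev1 y) => /kummer_prime_ev; rewrite red1.
  by apply/negP; apply: irreducible_ndvd1.
- move=> _ [p _ <-] ngp; have {}ngp : ~~ (g %| red hP p).
    by apply/negP=> gp; apply: ngp; apply/kummer_prime_ev.
  have [u gu] := irreducible_inv_mod irr_g ngp.
  exists (ev (lift_red u)); first by exists (lift_red u).
  rewrite -evM -(ev1 y) -evB; apply/kummer_prime_ev.
  by rewrite redB redM red1 lift_redK mulrC.
- exists (emb P), (ev (lift_red h)).
  have nh : ~ kummer_prime g (ev (lift_red h)).
    move/kummer_prime_ev; rewrite lift_redK; apply/negP.
    by rewrite -irreducible_poly_coprime.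
  have ev_range p : range ev (ev p) by exists p.
  split=> //.
    move=> _ [p /dvdpP[w gw] ->].
    have [q def_q] : exists q, lift_red h * p - f * lift_red w = P%:P * q.
      apply: (red_eq0 (hP := hP)); rewrite redB !redM !lift_redK gw red_f.
      by ring.
    exists (ev q) => //; rewrite -(evC y P) -!evM -def_q evB [ev (f * _)]evM.
    by rewrite fy0 mul0r subr0.
  have nM1 : ~ kummer_prime g 1.
    rewrite -(ev1 y) => /kummer_prime_ev; rewrite red1.
    by apply/negP; apply: irreducible_ndvd1.
  by exists 1, 1; rewrite expr1 -(ev1 y); split=> //; rewrite ev1.
- have sg : (0 < size g)%N by apply: leq_trans irr_g.1.
  have ev_comb (c : 'I_(size g).-1 -> {poly Fq}) :
      \sum_i emb (c i) * ev 'X^i = ev (\sum_i (c i)%:P * 'X^i).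
    rewrite raddf_sum; apply: eq_bigr => i _.
    by rewrite [RHS]evM evC.
  have red_comb (c : 'I_(size g).-1 -> {poly Fq}) :
      red hP (\sum_i (c i)%:P * 'X^i) = \sum_i (modP hP (c i))%:P * 'X^i.
    rewrite raddf_sum; apply: eq_bigr => i _.
    by rewrite [LHS]redM redC; congr (_ * _); apply: map_polyXn.
  exists (fun i => ev 'X^i); split=> [i //|c|_ [p _ <-]].
  + rewrite ev_comb => /kummer_prime_ev; rewrite red_comb => gc i.
    rewrite -(modP_eq0 hP) -[modP hP _](coef_sum_monomials (fun i => modP hP (c i))).
    set C := \sum_i _ in gc *; suff ->: C = 0 by rewrite coef0.
    apply/eqP/negPn/negP=> C0; have := dvdp_leq C0 gc.
    by rewrite leqNgt -(prednK sg) ltnS size_sum_monomials.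
  pose r := red hP p %% g.
  exists (fun i => liftP r`_i); rewrite ev_comb -evB; apply/kummer_prime_ev.
  rewrite redB red_comb (_ : \sum_i _ = r).
    by rewrite {1}(divp_eq (red hP p) g) addrK dvdp_mull.
  apply/polyP=> i; have [lti|lei] := ltnP i (size g).-1.
    have := coef_sum_monomials (fun i : 'I_(size g).-1 => modP hP (liftP r`_i)) (Ordinal lti).
    by move=> /= ->; rewrite liftPK.
  rewrite !nth_default //; last exact: leq_trans (size_sum_monomials _) lei.
  by apply: leq_trans lei; rewrite -ltnS prednK // ltn_modp -size_poly_gt0.
Qed.

End KummerPrime.

Lemma place_prime_mod O p q : place_above P O -> red hP p = red hP q ->
  vmax O (ev q) -> vmax O (ev p).
Proof.
move=> aboveO eq_red mq; have [vrO lies] := aboveO.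
have [r def_r] : exists r, p - q = P%:P * r.
  by apply: (red_eq0 (hP := hP)); rewrite redB eq_red subrr.
rewrite -(subrK q p) def_r evD evM evC mulrC; apply: (vmaxD vrO) mq.
apply: (vmaxMl vrO); first exact: place_ev.
exact: lies (vmax_prime_polynomial irrP).
Qed.

(** The theorem of Kummer and Dedekind, for a squarefree reduction. The product
    of the g(y) lies in P R, so the maximal ideal of every place above P
    contains some g(y), hence the prime (P, g(y)). *)
Lemma kummer_signature (gs : seq {poly kP}) :
  red hP f = \prod_(g <- gs) g ->
  {in gs, forall g, irreducible_poly g} -> pairwise (@coprimep _) gs ->
  sorted leq [seq (size (g : {poly kP})).-1 | g <- gs] ->
  is_signature F P (flatten [seq [:: 1; (size (g : {poly kP})).-1]%N | g <- gs]).
Proof.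
move=> red_f irr_gs coprime_gs sorted_gs.
pose g i := tnth (in_tuple gs) i.
have irr_g i : irreducible_poly (g i) by apply: irr_gs; apply: mem_tnth.
have coprime_g i j : i != j -> coprimep (g i) (g j).
  wlog ltij : i j / (i < j)%N.
    move=> IH ij; move: (ij); rewrite -val_eqE neq_ltn => /orP[/IH->//|/IH].
    by rewrite coprimep_sym eq_sym; apply.
  by move=> _; rewrite /g !(tnth_nth 0); apply: (pairwiseP 0 coprime_gs) => //=;
    rewrite inE ltn_ord.
have red_split i : red hP f = g i * \prod_(j | j != i) g j.
  by rewrite red_f big_tnth (bigD1 i).
pose ef : (size gs).-tuple (nat *l nat) :=
  map_tuple (fun g : {poly kP} => (1%N, (size g).-1)) (in_tuple gs).
have -> : flatten [seq [:: 1; (size (g : {poly kP})).-1]%N | g <- gs]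
    = flatten [seq [:: p.1; p.2] | p <- ef] by rewrite -map_comp.
apply: (signature_of_primes (M := fun i => kummer_prime (g i)) irrP generated_order).
- rewrite sorted_map; move: sorted_gs; rewrite sorted_map.
  by apply: sub_sorted => a b /= leab; rewrite leEprodlexi.
- move=> i j eqM; apply/eqP/negPn/negP=> ij.
  have : kummer_prime (g i) (ev (lift_red (g i))).
    by exists (lift_red (g i)); rewrite ?lift_redK.
  rewrite [kummer_prime (g i)]eqM => /(kummer_prime_ev (red_split j)).
  rewrite lift_redK; apply/negP; rewrite -irreducible_poly_coprime //.
  by apply: coprime_g; rewrite eq_sym.
- move=> i; rewrite tnth_map; apply: (kummer_uniformized _ _ (red_split i)) => //.
  apply: (big_ind (fun h => coprimep (g i) h)) => [|a b ca cb|j ji].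
  + exact: coprimep1.
  + by rewrite coprimepMr ca.
  + by apply: coprime_g; rewrite eq_sym.
move=> O aboveO; have [vrO lies] := aboveO.
have [i mgi] : exists i, vmax O (ev (lift_red (g i))).
  apply: contrapT => /forallNP nmg.
  suff [_] : O (ev (\prod_i lift_red (g i))) /\ ~ vmax O (ev (\prod_i lift_red (g i))).
    apply; apply: (place_prime_mod (q := f) aboveO).
      rewrite red_f [RHS]big_tnth rmorph_prod.
      by apply: eq_bigr => i _; apply: lift_redK.
    by rewrite fy0; apply/vmaxP; split; [apply: (vring0 vrO)|left].
  apply: (big_ind (fun p => O (ev p) /\ ~ vmax O (ev p))) => [|p q [Op nOp] [Oq nOq]|i _].
  + by rewrite ev1; split; [exact: (vring1 vrO)|exact: (vmax1 vrO)].
  + rewrite evM; split; first exact: (vringM vrO).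
    by case/(vmax_prime vrO Op Oq).
  + by split; [exact: place_ev|exact: nmg].
exists i => _ [p /dvdpP[w gw] ->].
apply: (place_prime_mod (q := lift_red w * lift_red (g i)) aboveO).
  by rewrite redM !lift_redK.
by rewrite evM; apply: (vmaxMl vrO) mgi; apply: place_ev.
Qed.

End Generated.

(** * Overorders with an explicit third basis element *)

Definition cubic (R : nzRingType) (A B : R) : {poly R} := 'X^3 - A%:P * 'X + B%:P.

Lemma size_cubic_tail (R : nzRingType) (A B : R) :
  (size (B%:P - A%:P * 'X)%R < 4)%N.
Proof.
apply: leq_ltn_trans (size_polyD _ _) _; rewrite size_polyN gtn_max.
rewrite size_polyC (leq_ltn_trans (leq_b1 _)) //=.
by rewrite (leq_ltn_trans (size_polyMleq _ _)) // size_polyC size_polyX; case: (_ == _).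
Qed.

Lemma cubicE (R : nzRingType) (A B : R) : cubic A B = 'X^3 + (B%:P - A%:P * 'X).
Proof. by rewrite /cubic -addrA [_ + B%:P]addrC. Qed.

Lemma size_cubic (R : nzRingType) (A B : R) : size (cubic A B) = 4%N.
Proof. by rewrite cubicE size_polyDl size_polyXn // size_cubic_tail. Qed.

Lemma monic_cubic (R : nzRingType) (A B : R) : cubic A B \is monic.
Proof.
by rewrite cubicE monicE lead_coefDl ?size_polyXn ?size_cubic_tail // lead_coefXn.
Qed.

Lemma map_cubic (R S : nzRingType) (phi : {rmorphism R -> S}) (A B : R) :
  map_poly phi (cubic A B) = cubic (phi A) (phi B).
Proof. by rewrite /cubic rmorphD rmorphB rmorphXn rmorphM /= map_polyX !map_polyC. Qed.

Lemma horner_cubic (R : comNzRingType) (A B t : R) :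
  (cubic A B).[t] = t ^+ 3 - A * t + B.
Proof. by rewrite /cubic !hornerE. Qed.

Section Overorder.
Variables (Fq : finFieldType) (F : fieldExtType {fraction {poly Fq}}).
Variables (P : {poly Fq}) (hP : monic_irreducible_poly P) (y : F).

Local Notation emb := (emb F).

Let irrP : irreducible_poly P := hP.1.

Variables d a c : {poly Fq}.
Hypothesis d0 : d != 0.

Local Notation f := (cubic (d * a) (d ^+ 2 * c)).

Hypotheses (irr_f : irreducible_poly (map_poly (@tofrac _) f)) (fy0 : ev y f = 0)
  (gen_y : forall z : F, exists p : {poly {fraction {poly Fq}}},
             z = (map_poly (in_alg F) p).[y]).

(** A divisor d of A with d^2 | B makes y^2 / d integral at P. *)
Definition theta : F := y ^+ 2 / emb d.

Definition tri (a0 a1 a2 : {poly Fq}) : F := emb a0 + emb a1 * y + emb a2 * theta.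

Lemma embd0 : emb d != 0.
Proof. by rewrite emb_eq0. Qed.

Lemma y_sqr : y * y = emb d * theta.
Proof. by rewrite /theta [RHS]mulrC divfK ?embd0 // expr2. Qed.

Lemma y_cubed : y ^+ 3 = emb d * emb a * y - emb d ^+ 2 * emb c.
Proof.
move: fy0; rewrite /ev map_cubic horner_cubic /=.
rewrite [emb (d * a)]embM [emb (_ * c)]embM embX => /eqP.
by rewrite addr_eq0 subr_eq addrC => /eqP.
Qed.

Lemma y_theta : y * theta = emb a * y - emb d * emb c.
Proof.
apply: (mulfI embd0); rewrite mulrCA -y_sqr.
by transitivity (y ^+ 3); [ring|rewrite y_cubed; ring].
Qed.

Lemma theta_sqr : theta * theta = emb a * theta - emb c * y.
Proof.
apply: (mulfI embd0); rewrite mulrA -y_sqr -mulrA y_theta mulrBr mulrCA y_sqr; ring.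
Qed.

Lemma triB a0 a1 a2 b0 b1 b2 :
  tri a0 a1 a2 - tri b0 b1 b2 = tri (a0 - b0) (a1 - b1) (a2 - b2).
Proof. by rewrite /tri !embB; ring. Qed.

Lemma triD a0 a1 a2 b0 b1 b2 :
  tri a0 a1 a2 + tri b0 b1 b2 = tri (a0 + b0) (a1 + b1) (a2 + b2).
Proof. by rewrite /tri !embD; ring. Qed.

Lemma triM a0 a1 a2 b0 b1 b2 : tri a0 a1 a2 * tri b0 b1 b2 =
  tri (a0 * b0 - (a1 * b2 + a2 * b1) * (d * c))
      (a0 * b1 + a1 * b0 + (a1 * b2 + a2 * b1) * a - a2 * b2 * c)
      (a0 * b2 + a2 * b0 + a1 * b1 * d + a2 * b2 * a).
Proof.
transitivity (emb a0 * emb b0 + (emb a0 * emb b1 + emb a1 * emb b0) * y +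
  (emb a0 * emb b2 + emb a2 * emb b0) * theta + emb a1 * emb b1 * (y * y) +
  (emb a1 * emb b2 + emb a2 * emb b1) * (y * theta) +
  emb a2 * emb b2 * (theta * theta)); first by rewrite /tri; ring.
rewrite y_sqr y_theta theta_sqr /tri.
rewrite !(embB, embD, embM); ring.
Qed.

Lemma tri_emb g : emb g = tri g 0 0.
Proof. by rewrite /tri !emb0 !mul0r !addr0. Qed.

Lemma tri_y : y = tri 0 1 0.
Proof. by rewrite /tri !emb0 emb1 mul1r mul0r add0r addr0. Qed.

Lemma tri_theta : theta = tri 0 0 1.
Proof. by rewrite /tri !emb0 emb1 mul1r mul0r !add0r. Qed.

Lemma tri_eq0 a0 a1 a2 : tri a0 a1 a2 = 0 -> [/\ a0 = 0, a1 = 0 & a2 = 0].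
Proof.
move=> t0; pose p : {poly {poly Fq}} := Poly [:: d * a0; d * a1; a2].
have p0 : p = 0.
  apply: (ev_eq0 irr_f fy0).
    by rewrite size_cubic ltnS; apply: size_Poly.
  have -> : p = (d * a0)%:P + (d * a1)%:P * 'X + a2%:P * 'X ^+ 2.
    by rewrite /p /= !cons_poly_def mul0r add0r; ring.
  rewrite !evD !evM !evC evX -[RHS](mulr0 (emb d)) -t0 /tri !embM.
  by rewrite !mulrDr [emb d * (_ * theta)]mulrCA -y_sqr; ring.
have pz i : [:: d * a0; d * a1; a2]`_i = 0 by rewrite -coef_Poly -/p p0 coef0.
split; last exact: (pz 2%N).
  by move/eqP: (pz 0%N); rewrite mulf_eq0 (negPf d0) => /eqP.
by move/eqP: (pz 1%N); rewrite mulf_eq0 (negPf d0) => /eqP.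
Qed.

Definition overorder : set F := [set z | exists a0 a1 a2, z = tri a0 a1 a2].

Lemma overorder_tri a0 a1 a2 : overorder (tri a0 a1 a2).
Proof. by exists a0, a1, a2. Qed.

Lemma place_theta O : place_above P O -> O theta.
Proof.
move=> aboveO; have [vrO _] := aboveO.
have Oy : O y by rewrite -(evX y); apply: (place_ev hP (monic_cubic _ _) fy0).
have Oemb g : O (emb g) by apply: (place_emb hP).
have [//|OVth] := vring_total vrO theta.
have [->|th0] := eqVneq theta 0; first exact: (vring0 vrO).
(* theta^2 = a theta - c y, divided by theta, has integral terms on the right *)
have -> : theta = emb a - emb c * y * theta^-1.
  by apply: (mulIf th0); rewrite mulrBl divfK // theta_sqr.
apply: (vringB vrO) => //; apply: (vringM vrO) OVth; exact: (vringM vrO).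
Qed.

Lemma overorder_ev p : overorder (ev y p).
Proof.
elim/poly_ind: p => [|p g [a0 [a1 [a2 IHp]]]].
  by rewrite -(rmorph0 (@polyC _)) evC tri_emb; apply: overorder_tri.
rewrite evD evM evX evC IHp tri_emb tri_y triM.
by rewrite triD; apply: overorder_tri.
Qed.

Lemma overorder_order : order_above P overorder.
Proof.
have gen := generated_order hP (monic_cubic _ _) fy0 gen_y.
split.
- by move=> g; rewrite tri_emb; apply: overorder_tri.
- by move=> _ _ [a0 [a1 [a2 ->]]] [b0 [b1 [b2 ->]]]; rewrite triB; apply: overorder_tri.
- by move=> _ _ [a0 [a1 [a2 ->]]] [b0 [b1 [b2 ->]]]; rewrite triM; apply: overorder_tri.
- move=> z; have [b b0 [p _ def_z]] := order_frac gen z.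
  by exists b => //; rewrite -def_z; apply: overorder_ev.
move=> O aboveO _ [a0 [a1 [a2 ->]]]; have [vrO _] := aboveO.
have Oemb g : O (emb g) by apply: (place_emb hP).
have Oy : O y by rewrite -(evX y); apply: (place_ev hP (monic_cubic _ _) fy0).
have Oth := place_theta aboveO.
by do 2 (apply: (vringD vrO); last exact: (vringM vrO)).
Qed.

Section OverorderPrime.
Variable sigma : {poly Fq}.
Hypotheses (Pdsigma : P %| d * sigma) (Pdc : P %| d * c)
  (Psigma : P %| sigma * (sigma - a)).

(** The kernel of the map from the order to Fq[x] / (P) that sends y to 0 and
    theta to s; for s = sigma the three divisibilities above say that it respects
    the products y y, y theta and theta theta. *)
Definition overorder_prime (s : {poly Fq}) : set F :=
  [set z | exists a0 a1 a2, P %| a0 + s * a2 /\ z = tri a0 a1 a2].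

Local Notation M := (overorder_prime sigma).

Lemma overorder_prime_tri a0 a1 a2 : M (tri a0 a1 a2) <-> P %| a0 + sigma * a2.
Proof.
split=> [[b0 [b1 [b2 [Pb /eqP]]]]|Pa]; last by exists a0, a1, a2.
rewrite -subr_eq0 triB => /eqP/tri_eq0[/subr0_eq-> _ /subr0_eq->] //.
Qed.

Lemma overorder_primeB u v : M u -> M v -> M (u - v).
Proof.
case=> [a0 [a1 [a2 [Pa ->]]]] [b0 [b1 [b2 [Pb ->]]]].
rewrite triB; apply/overorder_prime_tri.
have -> : a0 - b0 + sigma * (a2 - b2) = (a0 + sigma * a2) - (b0 + sigma * b2) by ring.
exact: dvdp_sub.
Qed.

Lemma overorder_primeMl u v : overorder u -> M v -> M (u * v).
Proof.
case=> [a0 [a1 [a2 ->]]] [b0 [b1 [b2 [Pb ->]]]].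
rewrite triM; apply/overorder_prime_tri.
set e0 := (X in P %| X).
have -> : e0 = (a0 + sigma * a2) * (b0 + sigma * b2)
    - (a1 * b2 + a2 * b1) * (d * c) + a1 * b1 * (d * sigma)
    - a2 * b2 * (sigma * (sigma - a)) by rewrite /e0; ring.
by apply: dvdp_sub; [apply: dvdp_add; [apply: dvdp_sub|]|]; apply: dvdp_mull.
Qed.

(** M is generated by P, y and theta - sigma, so it suffices to test these. *)
Lemma overorder_uniformized (e : nat) (pi s s' s'' : F) :
  M pi -> overorder s -> ~ M s ->
  (exists2 b, overorder b & s * emb P = pi * b) ->
  (exists2 b, overorder b & s * y = pi * b) ->
  (exists2 b, overorder b & s * (theta - emb sigma) = pi * b) ->
  overorder s' -> ~ M s' -> overorder s'' -> ~ M s'' ->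
  s' * emb P = s'' * pi ^+ e ->
  uniformized_prime P overorder M e 1.
Proof.
move=> Mpi Rs nMs [b1 Rb1 def_b1] [b2 Rb2 def_b2] [b3 Rb3 def_b3].
move=> Rs' nMs' Rs'' nMs'' def_P.
have ordR := overorder_order.
have [Remb RB RM _ _] := ordR.
have RD := orderD ordR.
have M_emb g : M (emb g) <-> P %| g.
  by rewrite tri_emb; split=> [/overorder_prime_tri|Pg]; [|apply/overorder_prime_tri];
    rewrite mulr0 addr0.
have nM1 : ~ M 1.
  by rewrite -(emb1 F) => /M_emb; apply/negP; apply: irreducible_ndvd1.
split=> //.
- by move=> _ [a0 [a1 [a2 [_ ->]]]]; apply: overorder_tri.
- exact: overorder_primeB.
- exact: overorder_primeMl.
- move=> _ [a0 [a1 [a2 ->]]] nMa.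
  have nPa : ~~ (P %| a0 + sigma * a2) by apply/negP=> /overorder_prime_tri.
  have [u Pu] := irreducible_inv_mod irrP nPa.
  exists (emb u) => //; rewrite mulrC -(emb1 F) !tri_emb triM triB.
  apply/overorder_prime_tri; apply: etrans Pu; congr (P %| _); ring.
- exact/M_emb.
- exists pi, s; split=> //; last by exists s', s''.
  move=> _ [a0 [a1 [a2 [/dvdpP[k Pk] ->]]]].
  exists (emb k * b1 + emb a1 * b2 + emb a2 * b3).
    by apply: (RD); [apply: (RD)|]; apply: RM.
  have e0 : emb a0 = emb k * emb P - emb sigma * emb a2.
    by rewrite -!embM -embB -Pk addrK.
  rewrite /tri e0.
  transitivity (emb k * (s * emb P) + emb a1 * (s * y)
                + emb a2 * (s * (theta - emb sigma))); first by ring.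
  by rewrite def_b1 def_b2 def_b3; ring.
exists (fun=> 1); split=> [i|g|_ [a0 [a1 [a2 ->]]]].
- by rewrite -(emb1 F).
- by rewrite big_ord1 mulr1 => /M_emb Pg i; rewrite ord1.
exists (fun=> a0 + sigma * a2); rewrite big_ord1 mulr1 tri_emb triB.
apply/overorder_prime_tri; rewrite (_ : _ + _ = 0) ?dvdp0 //; ring.
Qed.

Lemma overorder_prime_place O : place_above P O ->
  vmax O y -> vmax O (theta - emb sigma) -> M `<=` vmax O.
Proof.
move=> aboveO my mth _ [a0 [a1 [a2 [/dvdpP[k Pk] ->]]]].
have [vrO lies] := aboveO; have Oemb g : O (emb g) by apply: (place_emb hP).
have mP : vmax O (emb P) := lies _ (vmax_prime_polynomial irrP).
have -> : tri a0 a1 a2 = emb k * emb P + emb a1 * y + emb a2 * (theta - emb sigma).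
  by rewrite -embM -Pk embD embM /tri; ring.
by do 2?[apply: (vmaxD vrO)]; apply: (vmaxMl vrO).
Qed.

End OverorderPrime.

End Overorder.

(** * Ramified signatures *)

Section Ramified.
Variables (Fq : finFieldType) (F : fieldExtType {fraction {poly Fq}}).
Variables (P : {poly Fq}) (hP : monic_irreducible_poly P) (y : F).
Hypothesis gen_y : forall z : F, exists p : {poly {fraction {poly Fq}}},
  z = (map_poly (in_alg F) p).[y].

Local Notation emb := (emb F).

Let irrP : irreducible_poly P := hP.1.
Let P0 : P != 0 := irreducible_neq0 irrP.

Definition cubic_root (A B : {poly Fq}) : Prop :=
  irreducible_poly (map_poly (@tofrac _) (cubic A B)) /\ ev y (cubic A B) = 0.

Lemma place_prime O : place_above P O -> vmax O (emb P).
Proof. by case=> _ lies; apply: lies (vmax_prime_polynomial irrP). Qed.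

Lemma place_y A B O : cubic_root (P * A) (P * B) -> place_above P O -> vmax O y.
Proof.
move=> [_ fy0] aboveO; have [vrO _] := aboveO.
have Oemb g : O (emb g) by apply: (place_emb hP).
have Oy : O y by rewrite -(evX y); apply: (place_ev hP (monic_cubic _ _) fy0).
apply: (@vmax_expr _ _ _ vrO _ 3) => //.
have -> : y ^+ 3 = (emb A * y - emb B) * emb P.
  move: fy0; rewrite /ev map_cubic horner_cubic /= !embM => fy0.
  by apply: subr0_eq; rewrite -[RHS]fy0; ring.
apply: (vmaxMl vrO); last exact: place_prime.
by apply: (vringB vrO) => //; apply: (vringM vrO).
Qed.

(** The polynomial is Eisenstein at P: y is a uniformizer, because
    P (B - A y) = - y^3 with B - A y a unit at the place. *)
Lemma signature_eisenstein (A B : {poly Fq}) : ~~ (P %| B) ->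
  cubic_root (P * A) (P * B) -> is_signature F P [:: 3; 1]%N.
Proof.
move=> nPB rootf; have [] := rootf.
have -> : P * A = 1 * (P * A) by rewrite mul1r.
have -> : P * B = 1 ^+ 2 * (P * B) by rewrite expr1n mul1r.
move=> irr fy0; have d0 : (1 : {poly Fq}) != 0 := oner_neq0 _.
have ordR := overorder_order hP d0 fy0 gen_y.
have M0P := @overorder_prime_tri _ _ P _ _ _ _ d0 irr fy0 0.
have yth := y_theta d0 fy0; have yy := y_sqr y d0; rewrite emb1 mul1r in yy.
rewrite emb1 mul1r !embM in yth.
have nP1 := irreducible_ndvd1 irrP.
have RT a0 a1 a2 : overorder y 1 (tri y 1 a0 a1 a2) by exists a0, a1, a2.
have nM u v w : ~~ (P %| u) -> ~ overorder_prime P y 1 0 (tri y 1 u v w).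
  by move=> nPu /M0P; rewrite mul0r addr0; apply/negP.
apply: (signature_of_primes (m := 1) (ef := [tuple (3, 1)%N])
          (M := fun=> overorder_prime P y 1 0) irrP ordR) => //.
- by move=> i j _; rewrite !ord1.
- move=> i; rewrite ord1 /=.
  (* s = s' = B - A y, the unit - y^3 / P *)
  apply: (overorder_uniformized hP d0 irr fy0 gen_y _ _ _ (pi := y)
    (s := tri y 1 B (- A) 0) (s' := tri y 1 B (- A) 0) (s'' := tri y 1 (-1) 0 0)) => //.
  + by rewrite mulr0 dvdp0.
  + by rewrite mul1r dvdp_mulr.
  + by rewrite mul0r dvdp0.
  + by rewrite [y in overorder_prime _ _ _ _ y](tri_y y 1); apply/M0P; rewrite mul0r addr0 dvdp0.
  + exact: nM.
  + exists (tri y 1 0 0 (-1)) => //; rewrite /tri !(embN, emb0, emb1).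
    apply: subr0_eq; transitivity (y * theta y 1 - (emb P * emb A * y - emb P * emb B)).
      by ring.
    by rewrite yth subrr.
  + by exists (tri y 1 B (- A) 0) => //; rewrite mulrC.
  + exists (tri y 1 0 1 0 * tri y 1 B (- A) 0); first exact: (orderM ordR).
    by rewrite -tri_y emb0 subr0 -yy; ring.
  + exact: nM.
  + by apply: nM; rewrite dvdpNr.
  + rewrite /tri !(embN, emb0, emb1); apply: subr0_eq.
    transitivity (y * (y * y - theta y 1)
      + (y * theta y 1 - (emb P * emb A * y - emb P * emb B))); first by ring.
    by rewrite yy yth !subrr mulr0 addr0.
move=> O aboveO; exists ord0; have [vrO _] := aboveO.
have my := place_y rootf aboveO.
apply: (overorder_prime_place hP aboveO my).
by rewrite emb0 subr0 -yy; apply: (vmaxMl vrO (vmax_sub my) my).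
Qed.

(** Here y has valuation 2 and P valuation 3, so theta = y^2 / P is
    a uniformizer; the factor s' below is the unit theta^3 / P. *)
Lemma signature_eisenstein2 (A B : {poly Fq}) : ~~ (P %| B) ->
  cubic_root (P * (P * A)) (P ^+ 2 * B) -> is_signature F P [:: 3; 1]%N.
Proof.
move=> nPB rootf; have [irr fy0] := rootf.
have ordR := overorder_order hP P0 fy0 gen_y.
have M0P := @overorder_prime_tri _ _ P _ _ _ _ P0 irr fy0 0.
have yth := y_theta P0 fy0; have yy := y_sqr y P0; have thth := theta_sqr P0 fy0.
rewrite !embM in yth thth.
have nP1 := irreducible_ndvd1 irrP.
have RT a0 a1 a2 : overorder y P (tri y P a0 a1 a2) by exists a0, a1, a2.
have nM u v w : ~~ (P %| u) -> ~ overorder_prime P y P 0 (tri y P u v w).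
  by move=> nPu /M0P; rewrite mul0r addr0; apply/negP.
have nPB2 : ~~ (P %| B ^+ 2) by rewrite expr2 irreducible_dvdM // negb_or nPB.
set th := theta y P in yth yy thth *.
apply: (signature_of_primes (m := 1) (ef := [tuple (3, 1)%N])
          (M := fun=> overorder_prime P y P 0) irrP ordR) => //.
- by move=> i j _; rewrite !ord1.
- move=> i; rewrite ord1 /=.
  (* s = B (B - A y), where P (B - A y) = - y theta and B y is a multiple of
     theta; each identity below is a combination of the products of y and theta *)
  apply: (overorder_uniformized hP P0 irr fy0 gen_y _ _ _ (pi := th)
    (s := tri y P (B ^+ 2) (- (A * B)) 0)
    (s' := tri y P (B ^+ 2) (- (A * B + A * B)) (P * A ^+ 2))
    (s'' := tri y P 1 0 0)) => //; try by apply: nM.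
  + by rewrite mulr0 dvdp0.
  + by rewrite dvdp_mulr.
  + by rewrite mul0r dvdp0.
  + by rewrite /th tri_theta; apply/M0P; rewrite mul0r addr0 dvdp0.
  + exists (tri y P 0 (- B) 0) => //; rewrite /tri -/th !(embN, emb0, embM, embX).
    apply: subr0_eq; transitivity (emb B *
      (y * th - (emb P * emb A * y - emb P * emb B))); first by ring.
    by rewrite yth subrr mulr0.
  + exists (tri y P 0 0 (- B)) => //; rewrite /tri -/th !(embN, emb0, embM, embX).
    apply: subr0_eq; transitivity (
      emb B * (th * th - (emb P * emb A * th - emb B * y))
      - emb A * emb B * (y * y - emb P * th)); first by ring.
    by rewrite thth yy !subrr !mulr0 subr0.
  + exists (tri y P (B ^+ 2) (- (A * B)) 0) => //; rewrite emb0 subr0; exact: mulrC.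
  + rewrite /tri -/th !(embN, emb0, emb1, embM, embX, embD).
    apply: subr0_eq; transitivity (
      emb B * (y * th - (emb P * emb A * y - emb P * emb B))
      - (th + emb P * emb A) * (th * th - (emb P * emb A * th - emb B * y))).
      by ring.
    by rewrite yth thth !subrr !mulr0 subr0.
move=> O aboveO; exists ord0; have [vrO _] := aboveO.
have my : vmax O y.
  apply: (place_y (A := P * A) (B := P * B)) aboveO.
  by rewrite [P * (P * B)]mulrA -expr2.
have Oth : O th := place_theta hP P0 fy0 aboveO.
have Oemb g : O (emb g) by apply: (place_emb hP).
apply: (overorder_prime_place hP aboveO my); rewrite emb0 subr0 -/th.
apply: (@vmax_expr _ _ _ vrO _ 2) => //; rewrite expr2 thth.
apply: (vmaxD vrO); last by apply: (vmaxN vrO); apply: (vmaxMl vrO).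
rewrite -mulrA mulrC; apply: (vmaxMl vrO); last exact: place_prime.
exact: (vringM vrO).
Qed.

(** Here theta satisfies theta (theta - A) = 0 modulo P with A a unit: the
    residues 0 and A of theta separate an unramified place from a ramified
    one. At the former theta - A is a unit, and y (theta - A) = - P B
    makes P a uniformizer; at the latter theta is a unit, and P theta = y^2 makes
    y one. *)
Lemma signature_partially_ramified (A B : {poly Fq}) : ~~ (P %| A) ->
  cubic_root (P * A) (P ^+ 2 * B) -> is_signature F P [:: 1; 1; 2; 1]%N.
Proof.
move=> nPA rootf; have [irr fy0] := rootf.
have ordR := overorder_order hP P0 fy0 gen_y.
have MP := @overorder_prime_tri _ _ P _ _ _ _ P0 irr fy0.
have yth := y_theta P0 fy0; have yy := y_sqr y P0; have thth := theta_sqr P0 fy0.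
have nP1 := irreducible_ndvd1 irrP.
have RT a0 a1 a2 : overorder y P (tri y P a0 a1 a2) by exists a0, a1, a2.
have nM r u v w : ~~ (P %| u + r * w) -> ~ overorder_prime P y P r (tri y P u v w).
  by move=> nPu /MP; apply/negP.
have nPA2 : ~~ (P %| A ^+ 2) by rewrite expr2 irreducible_dvdM // negb_or nPA.
set th := theta y P in yth yy thth *.
have tri_th : th = tri y P 0 0 1 by exact: tri_theta.
apply: (signature_of_primes (m := 2) (ef := [tuple (1, 1)%N; (2, 1)%N])
  (M := fun i => overorder_prime P y P (if i == ord0 then 0 else A)) irrP ordR).
- by [].
- have neqM : overorder_prime P y P 0 <> overorder_prime P y P A.
    move=> eqM; have : overorder_prime P y P 0 th.
      by rewrite tri_th; apply/MP; rewrite mul0r addr0 dvdp0.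
    by rewrite eqM tri_th => /MP; rewrite add0r mulr1; apply/negP.
  move=> i j; case: (unliftP ord0 i) => [i'|] ->; case: (unliftP ord0 j) => [j'|] -> //=.
  + by rewrite !ord1.
  + by move/esym/neqM.
- move=> i; case: (unliftP ord0 i) => [i'|] -> /=.
    (* the ramified place: s = theta *)
    rewrite ord1; apply: (overorder_uniformized hP P0 irr fy0 gen_y _ _ _ (pi := y)
      (s := tri y P 0 0 1) (s' := tri y P 0 0 1) (s'' := tri y P 1 0 0)) => //;
      try by apply: nM; rewrite ?mulr0 ?mulr1 ?addr0 ?add0r.
    + by rewrite dvdp_mulr.
    + by rewrite dvdp_mulr.
    + by rewrite subrr mulr0 dvdp0.
    + by rewrite [y in overorder_prime _ _ _ _ y](tri_y y P); apply/MP;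
        rewrite mulr0 addr0 dvdp0.
    + by exists (tri y P 0 1 0) => //; rewrite -tri_th -tri_y yy mulrC.
    + by exists (tri y P 0 0 1) => //; rewrite mulrC.
    + exists (tri y P (- B) 0 0) => //; rewrite -tri_th mulrBr thth.
      by rewrite /tri embN !emb0; ring.
    + by rewrite -tri_th -(tri_emb y P) emb1 mul1r expr2 yy mulrC.
  (* the unramified place: s = (theta - A)^2, as one factor theta - A brings
     theta into the ideal of y, and the second brings y into that of P *)
  apply: (overorder_uniformized hP P0 irr fy0 gen_y _ _ _ (pi := emb P)
    (s := tri y P (A ^+ 2) (- B) (- A)) (s' := tri y P 1 0 0)
    (s'' := tri y P 1 0 0)) => //; try by apply: nM; rewrite ?mul0r ?addr0.
  + by rewrite mulr0 dvdp0.
  + by rewrite dvdp_mulr.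
  + by rewrite mul0r dvdp0.
  + by rewrite (tri_emb y P); apply/MP; rewrite mul0r addr0.
  + by exists (tri y P (A ^+ 2) (- B) (- A)) => //; rewrite mulrC.
  + exists (tri y P (A * B) 0 (- B)) => //; rewrite /tri -/th !(embN, emb0, embM, embX).
    apply: subr0_eq; transitivity (
      - emb B * (y * y - emb P * th)
      - emb A * (y * th - (emb A * y - emb P * emb B))); first by ring.
    by rewrite yth yy !subrr !mulr0 subr0.
  + exists (tri y P (B ^+ 2) 0 0) => //; rewrite /tri -/th !(embN, emb0, embM, embX).
    apply: subr0_eq; transitivity (
      - emb B * (y * th - (emb A * y - emb P * emb B))
      - emb A * (th * th - (emb A * th - emb B * y))); first by ring.
    by rewrite yth thth !subrr !mulr0 subr0.
move=> O aboveO; have [vrO _] := aboveO.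
have my : vmax O y.
  apply: (place_y (A := A) (B := P * B)) aboveO.
  by rewrite mulrA -expr2.
have Oth : O th := place_theta hP P0 fy0 aboveO.
have Oemb g : O (emb g) by apply: (place_emb hP).
have : vmax O (th * (th - emb A)).
  have -> : th * (th - emb A) = - (emb B * y) by rewrite mulrBr thth; ring.
  by apply: (vmaxN vrO); apply: (vmaxMl vrO).
case/(vmax_prime vrO Oth (vringB vrO Oth (Oemb A))) => mth.
  by exists ord0; apply: (overorder_prime_place hP aboveO my); rewrite emb0 subr0.
by exists ord_max; apply: (overorder_prime_place hP aboveO my).
Qed.

End Ramified.

(** * The valuation of a polynomial *)

Section PolynomialValuation.
Variables (k : fieldType) (P : {poly k}).
Hypothesis irrP : irreducible_poly P.

Lemma vpoly_spec G : G != 0 ->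
  exists n, [/\ vpoly P G = (n%:Z)%:E, P ^+ n %| G & ~~ (P ^+ n.+1 %| G)].
Proof.
move=> G0; rewrite /vpoly (negPf G0).
have ltG n : P ^+ n %| G -> (n < size G)%N.
  have Pn0 : P ^+ n != 0 by rewrite expf_neq0 ?irreducible_neq0.
  move=> /(dvdp_leq G0); apply: leq_trans; rewrite -size_poly_gt0 in Pn0.
  rewrite -(prednK Pn0) ltnS size_exp leq_pmull // -subn1 subn_gt0.
  exact: irrP.1.
have G_gt0 : (0 < size G)%N by rewrite size_poly_gt0.
have [|i Pi def_max] := @eq_bigmax_cond _ [pred i : 'I_(size G) | P ^+ i %| G] (@nat_of_ord _).
  by apply/card_gt0P; exists (Ordinal G_gt0); rewrite inE expr0 dvd1p.
exists i; split=> //; first by congr (Posz _)%:E; exact: def_max.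
apply/negP=> PSi.
have := @leq_bigmax_cond _ [pred i : 'I_(size G) | P ^+ i %| G]
          (@nat_of_ord _) (Ordinal (ltG _ PSi)) PSi.
by rewrite def_max ltnn.
Qed.

Lemma vpoly_gt0 G : (0 < vpoly P G)%E -> P %| G.
Proof.
have [->|/vpoly_spec[n [-> PnG _]]] := eqVneq G 0; first by rewrite dvdp0.
by case: n PnG => // n PnG _; apply: dvdp_trans PnG; rewrite exprS dvdp_mulr.
Qed.

Lemma vpoly_eq0 G : vpoly P G = 0%E -> ~~ (P %| G).
Proof.
have [->|/vpoly_spec[n [-> _ nPG]] [n0]] := eqVneq G 0; first by rewrite /vpoly eqxx.
by move: nPG; rewrite n0 expr1.
Qed.

Lemma vpoly_eq1 G : vpoly P G = 1%E -> exists2 H, ~~ (P %| H) & G = P * H.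
Proof.
have [->|/vpoly_spec[n [-> PG nPG]] [n1]] := eqVneq G 0.
  by rewrite /vpoly eqxx.
move: PG nPG; rewrite n1 expr1 => /dvdpP[H ->]; exists H; last exact: mulrC.
by move: nPG; rewrite expr2 dvdp_mul2r // irreducible_neq0.
Qed.

Lemma vpoly_gt1 G : (1 < vpoly P G)%E -> exists H, G = P ^+ 2 * H.
Proof.
have [-> _|/vpoly_spec[n [-> PnG _]]] := eqVneq G 0; first by exists 0; rewrite mulr0.
case: n PnG => [|[|n]] // /dvdpP[H ->] _.
by exists (H * P ^+ n); rewrite [RHS]mulrCA -exprD.
Qed.

Lemma vpoly_le G H n : (vpoly P G <= vpoly P H)%E -> P ^+ n %| G -> P ^+ n %| H.
Proof.
have [->|/vpoly_spec[j [-> PjH _]]] := eqVneq H 0; first by rewrite dvdp0.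
have [->|/vpoly_spec[i [-> _ nPiG]]] := eqVneq G 0; first by rewrite /vpoly eqxx.
rewrite lee_fin lez_nat => leij PnG; apply: dvdp_trans PjH; apply: dvdp_exp2l.
apply: leq_trans leij; rewrite leqNgt; apply: contra nPiG => ltin.
exact: dvdp_trans (dvdp_exp2l _ ltin) PnG.
Qed.

End PolynomialValuation.

(** * Cubics over finite fields *)

Section FiniteFieldCubics.
Variables (k : finFieldType).

(** Here 3 is prime to the order of the multiplicative group: x = x^|k| = x^2. *)
Lemma cube_root1_trivial (x : k) : (#|k| %% 3 = 2)%N -> x ^+ 3 = 1 -> x = 1.
Proof.
move=> k2 x3; have x0 : x != 0.
  by apply/eqP=> x0; move/eqP: x3; rewrite x0 expr0n /= eq_sym oner_eq0.
have := expf_card x; rewrite (divn_eq #|k| 3) k2 mulnC exprD exprM x3 expr1n mul1r.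
by rewrite expr2 -{3}[x]mulr1 => /(mulfI x0).
Qed.

Lemma cube_root1_nontrivial : (#|k| %% 3 = 1)%N -> exists2 w : k, w ^+ 3 = 1 & w != 1.
Proof.
move=> k1; pose n := (#|k| %/ 3)%N.
have card_k : #|k| = (3 * n).+1 by rewrite (divn_eq #|k| 3) k1 addn1 mulnC.
have n0 : (0 < n)%N by have := card_finNzRing_gt1 k; rewrite card_k ltnS muln_gt0.
have pow_n (x : k) : x != 0 -> (x ^+ n) ^+ 3 = 1.
  move=> x0; apply: (mulfI x0); rewrite mulr1 -exprM mulnC -exprS -card_k.
  exact: expf_card.
(* 'X^n - 1 has too few roots to kill all 3 n nonzero elements *)
have [/existsP[x /andP[x0 xn]]|] := boolP [exists x : k, (x != 0) && (x ^+ n != 1)].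
  by exists (x ^+ n) => //; apply: pow_n.
rewrite negb_exists => /forallP all1.
have Xn0 : 'X^n - 1%:P != 0 :> {poly k} by rewrite -size_poly_eq0 size_XnsubC.
have := max_poly_roots Xn0 (rs := enum (predC1 (0 : k))).
rewrite enum_uniq size_XnsubC // -cardE cardC1 card_k /= => lt3n.
suff: (3 * n < n.+1)%N by rewrite ltnS leqNgt -{1}[n]mul1n ltn_mul2r n0.
apply: lt3n => //; apply/allP=> x; rewrite mem_enum => x0.
have := all1 x; rewrite [x != 0]x0 /= negbK => /eqP xn.
by rewrite rootE !hornerE xn subrr.
Qed.

Lemma pure_cubic_root (b t t0 : k) : t0 ^+ 3 = - b ->
  root (cubic 0 b) t = (t ^+ 3 == t0 ^+ 3).
Proof. by move=> ->; rewrite rootE horner_cubic mul0r subr0 addr_eq0. Qed.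

Lemma pure_cubic_three_roots (b t0 : k) :
  (#|k| %% 3 = 1)%N -> b != 0 -> t0 ^+ 3 = - b ->
  exists rs, [/\ uniq rs, size rs = 3%N & all (root (cubic 0 b)) rs].
Proof.
move=> k1 b0 t0b; have [w w3 w1] := cube_root1_nontrivial k1.
have nz : t0 != 0.
  by apply: contra_neq b0 => t00; rewrite -[b]opprK -t0b t00 expr0n oppr0.
have w0 : w != 0.
  by apply/eqP=> w0; move/eqP: w3; rewrite w0 expr0n eq_sym oner_eq0.
exists [seq t0 * u | u <- [:: 1; w; w ^+ 2]]; split=> //.
  rewrite (map_inj_uniq (mulfI nz)) /= !inE andbT negb_or [1 == w]eq_sym w1 /=.
  have -> : (w == w ^+ 2) = (1 == w).
    by rewrite expr2 -{1}[w]mulr1 (inj_eq (mulfI w0)).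
  rewrite ![1 == _]eq_sym w1 andbT.
  by apply: contra_neq w1 => w2; rewrite -w3 exprS w2 mulr1.
rewrite /= !(pure_cubic_root _ t0b) !exprMn w3 expr1n !mulr1.
by rewrite !eqxx.
Qed.

Lemma pure_cubic_one_root (b t0 : k) :
  (#|k| %% 3 = 2)%N -> b != 0 -> t0 ^+ 3 = - b ->
  forall t, root (cubic 0 b) t -> t = t0.
Proof.
move=> k2 b0 t0b t; rewrite (pure_cubic_root _ t0b) => /eqP t3.
have nz : t0 != 0.
  by apply: contra_neq b0 => t00; rewrite -[b]opprK -t0b t00 expr0n oppr0.
apply: (divIf nz); rewrite divff //; apply: cube_root1_trivial => //.
by rewrite expr_div_n t3 divff // expf_neq0.
Qed.

Section CharacteristicTwo.
Variables a b : k.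
Hypotheses (char2 : 2%N \in [pchar k]) (b0 : b != 0).

(** In characteristic 2 the discriminant of T^3 - a T + b is b^2, so there is no
    multiple root. *)
Lemma cubic_deriv_root t : root (cubic a b) t -> t ^+ 2 + t * t + (t ^+ 2 - a) != 0.
Proof.
rewrite rootE horner_cubic => /eqP ct; apply: contraNneq b0 => t2.
have -> : b = (t ^+ 3 - a * t + b) - t * (t ^+ 2 + t * t + (t ^+ 2 - a))
            + (t ^+ 3 + t ^+ 3) by ring.
by rewrite ct t2 mulr0 subrr add0r (addrr_pchar2 char2).
Qed.

Lemma cubic_three_roots (rs : seq k) : uniq rs -> size rs = 3%N ->
  all (root (cubic a b)) rs -> cubic a b = \prod_(t <- rs) ('X - t%:P).
Proof.
move=> uniq_rs size_rs roots_rs.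
rewrite [LHS](@all_roots_prod_XsubC _ _ rs) ?size_cubic ?size_rs ?uniq_rootsE //.
by rewrite (monicP (monic_cubic a b)) scale1r.
Qed.

(** The quotient of T^3 - a T + b by T - t when t is a root. *)
Definition cofactor (t : k) : {poly k} := 'X^2 + (t *: 'X + (t ^+ 2 - a)%:P).

Lemma size_cofactor t : size (cofactor t) = 3%N.
Proof.
rewrite /cofactor size_polyDl size_polyXn //.
apply: leq_ltn_trans (size_polyD _ _) _; rewrite gtn_max.
rewrite (leq_ltn_trans (size_scale_leq _ _)) ?size_polyX //.
by rewrite size_polyC (leq_ltn_trans (leq_b1 _)).
Qed.

Lemma horner_cofactor t u : (cofactor t).[u] = u ^+ 2 + t * u + (t ^+ 2 - a).
Proof. by rewrite /cofactor !hornerE; ring. Qed.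

Lemma cubic_cofactor t : root (cubic a b) t -> cubic a b = ('X - t%:P) * cofactor t.
Proof.
rewrite rootE horner_cubic => /eqP ct.
have -> : b = a * t - t ^+ 3 by apply: subr0_eq; rewrite -[RHS]ct; ring.
by rewrite /cubic /cofactor -mul_polyC !(polyCB, polyCM, polyC_exp); ring.
Qed.

Lemma cofactor_irreducible t : (forall u, root (cubic a b) u -> u = t) ->
  root (cubic a b) t -> irreducible_poly (cofactor t).
Proof.
move=> uniq_t root_t; apply: cubic_irreducible; first by rewrite size_cofactor.
move=> u; apply/negP=> root_u; have ut : u = t.
  by apply: uniq_t; rewrite (cubic_cofactor root_t) rootM root_u orbT.
by move: root_u; rewrite ut rootE horner_cofactor (negPf (cubic_deriv_root root_t)).
Qed.

Lemma cofactor_coprime t : root (cubic a b) t -> coprimep ('X - t%:P) (cofactor t).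
Proof.
move=> root_t; rewrite coprimep_sym coprimep_XsubC rootE horner_cofactor.
exact: cubic_deriv_root.
Qed.

End CharacteristicTwo.

End FiniteFieldCubics.

(** * Signatures at the primes not dividing B, and the theorem *)

Section Unramified.
Variables (Fq : finFieldType) (F : fieldExtType {fraction {poly Fq}}) (y : F).
Variables (A B P : {poly Fq}) (hP : monic_irreducible_poly P).

Local Notation kP := {poly %/ P with hP}.
Local Notation a := (modP hP A).
Local Notation b := (modP hP B).

Hypotheses (char2 : 2%N \in [pchar Fq]) (nPB : ~~ (P %| B)).
Hypothesis gen_y : forall z : F, exists p : {poly {fraction {poly Fq}}},
  z = (map_poly (in_alg F) p).[y].
Hypothesis rootf : cubic_root y A B.

Lemma modP_char2 : 2%N \in [pchar kP].
Proof. by rewrite pchar_qpoly. Qed.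

Lemma modP_neq0 : b != 0.
Proof. by rewrite modP_eq0. Qed.

Lemma red_cubic : red hP (cubic A B) = cubic a b.
Proof. exact: map_cubic. Qed.

Let kummer := kummer_signature (hP := hP) (monic_cubic A B) rootf.1 rootf.2 gen_y.

Lemma signature_three_roots (rs : seq kP) : uniq rs -> size rs = 3%N ->
  all (root (cubic a b)) rs -> is_signature F P [:: 1; 1; 1; 1; 1; 1]%N.
Proof.
move=> uniq_rs size_rs roots_rs.
have -> : [:: 1; 1; 1; 1; 1; 1]%N = flatten [seq [:: 1; (size (g : {poly kP})).-1]%N
    | g <- [seq 'X - t%:P | t <- rs]].
  rewrite -map_comp (eq_map (g := fun=> [:: 1; 1]%N)).
    by case: rs size_rs {uniq_rs roots_rs} => [|? [|? [|? []]]].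
  by move=> t; rewrite /comp size_XsubC.
apply: kummer.
- rewrite red_cubic big_map; exact: cubic_three_roots.
- by move=> _ /mapP[t _ ->]; apply: irredp_XsubC.
- rewrite pairwise_map; move: uniq_rs; rewrite uniq_pairwise.
  by apply: sub_pairwise => t u tu /=; rewrite coprimep_XsubC root_XsubC eq_sym.
- rewrite -map_comp (eq_map (g := fun=> 1%N)); last by move=> t /=; rewrite size_XsubC.
  by case: rs {uniq_rs size_rs roots_rs} => [|? s] //=; elim: s.
Qed.

Lemma signature_one_root (t : kP) : root (cubic a b) t ->
  (forall u, root (cubic a b) u -> u = t) -> is_signature F P [:: 1; 1; 1; 2]%N.
Proof.
move=> root_t uniq_t.
have -> : [:: 1; 1; 1; 2]%N = flatten [seq [:: 1; (size (g : {poly kP})).-1]%N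
    | g <- [:: 'X - t%:P; cofactor a t]].
  by rewrite /= size_XsubC size_cofactor.
apply: kummer.
- by rewrite red_cubic !big_cons big_nil mulr1; apply: cubic_cofactor.
- move=> g; rewrite !inE => /orP[]/eqP->; first exact: irredp_XsubC.
  exact: (cofactor_irreducible modP_char2 modP_neq0).
- by rewrite /= !andbT; apply: (cofactor_coprime modP_char2 modP_neq0).
- by rewrite /= size_XsubC size_cofactor.
Qed.

Lemma signature_no_root : (forall t : kP, ~~ root (cubic a b) t) ->
  is_signature F P [:: 1; 3]%N.
Proof.
move=> no_root.
have -> : [:: 1; 3]%N = flatten [seq [:: 1; (size (g : {poly kP})).-1]%N
    | g <- [:: cubic a b]] by rewrite /= size_cubic.
apply: kummer => //.
- by rewrite red_cubic big_seq1.
- move=> g; rewrite !inE => /eqP->; apply: cubic_irreducible => //.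
  by rewrite size_cubic.
Qed.

End Unramified.

Theorem theorem2p2p7 (Fq : finFieldType) (F : fieldExtType {fraction {poly Fq}})
    (y : F) (A B P : {poly Fq}) (hP : monic_irreducible_poly P) :
  2%N \in [pchar Fq] ->
  standard_form y A B ->
  let m1 := vpoly P A in
  let m0 := vpoly P B in
  let N := (#|Fq| ^ (size P).-1)%N in
  [/\ [/\ (m1 > 0)%E, m0 = 0%E, (N%:Z = 1 %[mod 3])%Z & cube_mod hP (- B)] \/
      [/\ m1 = 0%E, m0 = 0%E & nroots_mod hP A B = 3%N] ->
        is_signature F P [:: 1; 1; 1; 1; 1; 1]%N,
      [/\ (m1 > 0)%E, m0 = 0%E, (N%:Z = -1 %[mod 3])%Z & cube_mod hP (- B)] \/
      [/\ m1 = 0%E, m0 = 0%E & nroots_mod hP A B = 1%N] ->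
        is_signature F P [:: 1; 1; 1; 2]%N,
      m1 = 1%E /\ (1 < m0)%E ->
        is_signature F P [:: 1; 1; 2; 1]%N,
      [/\ (m1 > 0)%E, m0 = 0%E & ~ cube_mod hP (- B)] \/
      [/\ m1 = 0%E, m0 = 0%E & nroots_mod hP A B = 0%N] ->
        is_signature F P [:: 1; 3]%N
    & (1 <= m0)%E /\ (m0 <= m1)%E ->
        is_signature F P [:: 3; 1]%N].
Proof.
move=> char2 sf m1 m0 N.
have irrP : irreducible_poly P := hP.1.
have gen_y (z : F) : exists p : {poly {fraction {poly Fq}}},
    z = (map_poly (in_alg F) p).[y].
  have /Fadjoin_polyP[q /polyOver1P[p ->] ->] : z \in <<1; y>>%VS.
    by rewrite (sf_gen sf) memvf.
  by exists p.
have rootf : cubic_root y A B.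
  split; first by rewrite map_cubic; apply: sf_irreducible sf.
  by rewrite /ev map_cubic horner_cubic; apply: sf_root sf.
have card_k : #|{poly %/ P with hP}| = N by exact: card_qfpoly.
have modP_A : (0 < m1)%E -> modP hP A = 0.
  by move=> /(vpoly_gt0 irrP) PA; apply/eqP; rewrite modP_eq0.
split.
- case=> [[/modP_A a0 /(vpoly_eq0 irrP) nPB N1 [t0 t0B]]|[_ /(vpoly_eq0 irrP) nPB n3]].
    have [|||rs [uniq_rs size_rs roots_rs]] := @pure_cubic_three_roots _ (modP hP B) t0.
    + by rewrite card_k; move/eqP: N1; rewrite !modz_nat => /eqP[].
    + exact: modP_neq0.
    + by rewrite t0B rmorphN.
    by rewrite -a0 in roots_rs; apply: (signature_three_roots gen_y rootf uniq_rs).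
  apply: (signature_three_roots (hP := hP) gen_y rootf
    (rs := enum [set t | root (cubic (modP hP A) (modP hP B)) t]%SET)) => //.
  + exact: enum_uniq.
  + by rewrite -cardE.
  + by apply/allP=> t; rewrite mem_enum inE.
- case=> [[/modP_A a0 /(vpoly_eq0 irrP) nPB N2 [t0 t0B]]|[_ /(vpoly_eq0 irrP) nPB n1]].
    have t0b : t0 ^+ 3 = - modP hP B by rewrite t0B rmorphN.
    apply: (signature_one_root (hP := hP) char2 nPB gen_y rootf (t := t0)) => //; rewrite a0.
      by rewrite (pure_cubic_root _ t0b).
    apply: pure_cubic_one_root t0b; last exact: modP_neq0.
    by rewrite card_k; move/eqP: N2; rewrite !modz_nat => /eqP[].
  have /eqP/cards1P[t def_t] := n1.
  have roott u : root (cubic (modP hP A) (modP hP B)) u = (u == t).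
    by have /setP/(_ u) := def_t; rewrite !inE.
  apply: (signature_one_root (hP := hP) char2 nPB gen_y rootf (t := t)) => //.
    by rewrite roott.
  by move=> u; rewrite roott => /eqP.
- case=> /(vpoly_eq1 irrP)[A1 nPA1 def_A] /(vpoly_gt1 irrP)[B1 def_B].
  rewrite def_A def_B in rootf.
  exact: (signature_partially_ramified hP gen_y nPA1 rootf).
- case=> [[/modP_A a0 /(vpoly_eq0 irrP) nPB ncube]|[_ /(vpoly_eq0 irrP) nPB n0]].
    apply: (signature_no_root (hP := hP) gen_y rootf) => // t; apply/negP.
    rewrite a0 rootE horner_cubic mul0r subr0 addr_eq0 => /eqP tB.
    by apply: ncube; exists t; rewrite rmorphN.
  apply: (signature_no_root (hP := hP) gen_y rootf) => // t; apply/negP=> roott.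
  move/eqP: n0; rewrite cards_eq0 => /eqP/setP/(_ t).
  by rewrite !inE roott.
case=> ge1 le01.
have PB : P %| B by apply: (vpoly_gt0 irrP); apply: lt_le_trans ge1.
have pow n : P ^+ n %| B -> P ^+ n %| A by apply: (vpoly_le irrP le01).
have [/dvdpP[B1 def_B]|nP2B] := boolP (P ^+ 2 %| B).
  have /dvdpP[A1 def_A] : P ^+ 2 %| A by apply: pow; rewrite def_B dvdp_mull.
  have nPB1 : ~~ (P %| B1).
    apply/negP=> /dvdpP[B2 def_B1].
    have := sf_minimal sf (Q := P); rewrite leqNgt irrP.1 => /(_ _ _)/negP[] //.
      by rewrite def_A dvdp_mull.
    by rewrite def_B def_B1 -mulrA -exprS dvdp_mull.
  apply: (signature_eisenstein2 hP gen_y nPB1 (A := A1)).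
  by rewrite mulrA -expr2 mulrC -def_A mulrC -def_B.
have PA : P %| A by have := pow 1%N; rewrite !expr1; apply.
move: PB nP2B rootf => /dvdpP[B1 ->]; rewrite expr2 dvdp_mul2r; last exact: irreducible_neq0.
case/dvdpP: PA => A1 -> nPB1; rewrite ![_ * P]mulrC.
exact: (signature_eisenstein hP gen_y).
Qed.
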